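(* Let $G$ be a simple, simply-connected linear algebraic group over $\mathbb{C}$. (a) If $G$ is of type $A_r$, the number of extremal rays of $\mathscr{K}(G)$ is $\binom{r+1}{3}+\binom{r+1}{2}+\binom{r+1}{1}-1$. (b) If $G$ is of type $D_r$, the number of extremal rays of $\mathscr{K}(G)$ is $\binom{r}{3}+3\binom{r}{2}+2\binom{r}{1}-3$. (c) If $G$ is of type $E_r$, the number of extremal rays of $\mathscr{K}(G)$ is $\binom{r}{3}+4\binom{r}{2}+\binom{r}{1}-8$.
   Context: Types: $A_r$ with $r\ge 1$, $D_r$ with $r\ge 4$, $E_r$ with $r\in\{6,7,8\}$; the convention $\binom{2}{3}=0$ is used. Fix a maximal torus and Borel subgroup $T\subset B\subset G$, with simple coroots $\alpha_1^\vee,\dots,\alpha_r^\vee$ and fundamental coweights $x_1,\dots,x_r\in X_*(T)\otimes\mathbb{Q}$ dual to the simple roots ($\langle\alpha_i,x_j\rangle=\delta_{ij}$). The Kostka cone $\mathscr{K}(G)\subset (X^*(T)\otimes\mathbb{Q})^2$ is the rational cone generated by the pairs $(\lambda,\mu)$ of dominant integral weights such that the $\mu$-weight space of the irreducible representation $V_\lambda$ of highest weight $\lambda$ is nonzero; equivalently it is the set of pairs $(\lambda,\mu)$ with $\langle\lambda-\mu,x_i\rangle\ge 0$, $\langle\lambda,\alpha_i^\vee\rangle\ge 0$, $\langle\mu,\alpha_i^\vee\rangle\ge 0$ for all $i\in\{1,\dots,r\}$. *)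

(* Defs.v *)
From HB Require Import structures.
From mathcomp Require Import all_boot all_order all_algebra.
From mathcomp Require Import boolp classical_sets functions cardinality reals.
From mathcomp Require Import complex.

Set Implicit Arguments.
Unset Strict Implicit.
Unset Printing Implicit Defensive.

Import Order.TTheory GRing.Theory Num.Theory.

Local Open Scope ring_scope.
Local Open Scope classical_set_scope.

(* Bourbaki's numbering of the simple roots, shifted so that it starts at 0. *)

Definition edge_A (i j : nat) : bool := j == i.+1.

Definition edge_D (r i j : nat) : bool :=
  ((j == i.+1) && (j < r.-1)%N) || ((i == r - 3)%N && (j == r - 1)%N).

Definition edge_E (i j : nat) : bool :=
  [|| (i == 0)%N && (j == 2)%N, (i == 1)%N && (j == 3)%N
    | (2 <= i)%N && (j == i.+1)].

Definition cartan_of (edge : rel nat) (r : nat) : 'M[int]_r :=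
  \matrix_(i, j) (if i == j then 2
                  else if edge i j || edge j i then -1 else 0).

Definition cartan_A (r : nat) : 'M[int]_r := cartan_of edge_A r.
Definition cartan_D (r : nat) : 'M[int]_r := cartan_of (edge_D r) r.
Definition cartan_E (r : nat) : 'M[int]_r := cartan_of edge_E r.

(* [X^*(T) (x) Q] in the basis of fundamental weights: coordinate [i] of
   [lam] is [<lam, alpha_i^vee>].  Since G is simply connected, [X^*(T)] is the
   whole weight lattice, i.e. the integral vectors. *)
Notation weightQ r := 'rV[rat]_r.

Definition pairing (r : nat) (lam : weightQ r) (i : 'I_r) : rat := lam 0 i.

Definition dominant_integral (r : nat) (lam : weightQ r) : Prop :=
  forall i, pairing lam i \is a Num.nat.

Section Representations.
Variables (C : fieldType) (r : nat) (A : 'M[int]_r).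

Definition bracket (V : vectType C) (x y : 'End(V)) : 'End(V) :=
  ((x \o y)%VF - (y \o x)%VF).

(* A finite-dimensional representation of the semisimple Lie algebra with
   Cartan matrix A, given on the Chevalley generators e_i, f_i, h_i and
   subject to Serre's presentation, where [A i j = <alpha_j, alpha_i^vee>].
   When C is the field of complex numbers, differentiation identifies the
   rational representations of the simply connected group G with these, keeping
   subrepresentations and weight spaces. *)
Record representation := Representation {
  rep_space : vectType C;
  rep_e : 'I_r -> 'End(rep_space);
  rep_f : 'I_r -> 'End(rep_space);
  rep_h : 'I_r -> 'End(rep_space);
  rep_hh : forall i j, bracket (rep_h i) (rep_h j) = 0;
  rep_ef : forall i j,
    bracket (rep_e i) (rep_f j) = if i == j then rep_h i else 0;
  rep_he : forall i j, bracket (rep_h i) (rep_e j) = (A i j)%:~R *: rep_e j;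
  rep_hf : forall i j,
    bracket (rep_h i) (rep_f j) = - (A i j)%:~R *: rep_f j;
  rep_serre_e : forall i j, i != j ->
    iter (absz (1 - A i j)) (bracket (rep_e i)) (rep_e j) = 0;
  rep_serre_f : forall i j, i != j ->
    iter (absz (1 - A i j)) (bracket (rep_f i)) (rep_f j) = 0
}.

Definition stable (V : representation) (U : {vspace rep_space V}) : Prop :=
  forall i, [/\ (rep_e V i @: U <= U)%VS, (rep_f V i @: U <= U)%VS
              & (rep_h V i @: U <= U)%VS].

Definition irreducible_rep (V : representation) : Prop :=
  (fullv : {vspace rep_space V}) <> 0%VS /\
  forall U : {vspace rep_space V}, stable U -> U = 0%VS \/ U = fullv.

Definition weight_space (V : representation) (mu : weightQ r) :
    {vspace rep_space V} :=
  (\bigcap_(i < r) passmx.leigenspace (rep_h V i) (ratr (pairing mu i)))%VS.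

Definition has_highest_weight (V : representation) (lam : weightQ r) : Prop :=
  exists v : rep_space V,
    [/\ v != 0, v \in weight_space V lam & forall i, rep_e V i v = 0].

End Representations.

Definition cone_generated_by (E : lmodType rat) (S : set E) : set E :=
  [set x | exists (n : nat) (c : 'I_n -> rat) (p : 'I_n -> E),
     (forall k, 0 <= c k /\ S (p k)) /\ x = \sum_(k < n) c k *: p k].

Definition kostka_pairs (R : realType) (r : nat) (A : 'M[int]_r) :
    set (weightQ r * weightQ r) :=
  [set p | [/\ dominant_integral p.1, dominant_integral p.2 &
     exists V : representation R[i] A,
       [/\ irreducible_rep V, has_highest_weight V p.1
         & weight_space V p.2 <> 0%VS]]].

Definition kostka_cone (R : realType) (r : nat) (A : 'M[int]_r) :
    set (weightQ r * weightQ r) :=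
  cone_generated_by (kostka_pairs R A).

Definition ray (E : lmodType rat) (x : E) : set E :=
  [set y | exists2 t : rat, 0 <= t & y = t *: x].

Definition is_extremal_ray (E : lmodType rat) (K : set E) (rho : set E) : Prop :=
  [/\ exists2 x : E, x != 0 & rho = ray x,
      rho `<=` K
    & forall y z, K y -> K z -> rho (y + z) -> rho y /\ rho z].

Definition extremal_rays (E : lmodType rat) (K : set E) : set (set E) :=
  [set rho | is_extremal_ray K rho].

(* Main.v *)
(* In the coordinates [(b, mu)], where [lam - mu = \sum_k b_k alpha_k], the Kostka cone is the
   cone [b >= 0], [lam >= 0], [mu >= 0].  Subtracting a small multiple of a suitable generator
   shows that its extremal rays are spanned by the pairs [(omega_j, omega_j)] and the pairs
   [(omega_j, omega_j - omega_{I,j})], where [I] is a connected subset of the Dynkin diagram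
   containing [j] and [omega_{I,j}] is the fundamental weight at [j] of the Levi subgroup of
   type [I].  There are [r + \sum_I |I|] of them, [I] running over the nonempty connected subsets.

   That the cone generated by representations is this polyhedral cone needs the irreducible
   modules [L(lam)].  They are realized inside the coinduced module of all functions on words in
   the simple roots: there the raising operators act freely, the lowering operators already
   satisfy the Serre relations, and [L(lam)] is generated by the indicator of the empty word.
   It is finite dimensional because its weights are bounded in norm by [lam]. *)

From HB Require Import structures.
Require Import Defs.
From mathcomp Require Import all_boot all_order all_algebra.
From mathcomp Require Import boolp classical_sets functions cardinality reals.
From mathcomp Require Import complex ring lra zify.

Set Implicit Arguments.
Unset Strict Implicit.
Unset Printing Implicit Defensive.

Import Order.TTheory GRing.Theory Num.Theory.

Local Open Scope ring_scope.

(** * The irreducible module of highest weight [lam] *)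

(** The coinduced model stands in for the usual quotient of a Verma module. A function killed by
    every raising operator vanishes on all nonempty words, so it is a multiple of the highest weight
    vector; this is what lies behind both the integrability relations and irreducibility, and no
    basis of an enveloping algebra is needed. That every dominant [mu] below [lam] really occurs as
    a weight is seen by lowering step by step from [lam] towards [mu]: positive definiteness
    excludes getting stuck on the way. The norm bound reflects in one simple root at a time, through
    sl2 strings, so no Weyl group appears. For the count, each Dynkin diagram is oriented as a
    rooted tree. A subset is nonempty and connected exactly when a single one of its members has no
    parent inside it. The same orientation diagonalizes the quadratic form, which gives positive
    definiteness. *)

Section CoVerma.
Variables (C : numFieldType) (r : nat) (A : 'M[int]_r) (lam : 'I_r -> nat).
Hypothesis diagA : forall i, A i i = 2.
Hypothesis symA : forall i j, A i j = A j i.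
Hypothesis offA : forall i j, i != j -> A i j = 0 \/ A i j = -1.

(* [phi u] stands for the coefficient of the highest weight vector in
   [e_{u_k} (... (e_{u_1} phi))]; the recursion defining [opF] is then forced by
   [e_k f_i = f_i e_k + (k == i) h_i]. *)
Definition coverma := seq 'I_r -> C^o.

Implicit Types (i j k : 'I_r) (u w : seq 'I_r) (phi psi : coverma).

(** Raising along [u] leads to the highest weight, so the value at [u] sits in weight [lam] minus
    the simple roots listed in [u]. *)
Definition word_weight i u : int := (lam i)%:Z - \sum_(k <- u) A i k.

Definition opE i phi : coverma := fun u => phi (i :: u).
Definition opH i phi : coverma := fun u => (word_weight i u)%:~R * phi u.
Fixpoint opF i phi u : C^o :=
  if u is k :: u' then opF i (opE k phi) u' + (if k == i then opH i phi u' else 0)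
  else 0.

Definition hwv : coverma := fun u => (u == [::])%:R.

Lemma cvD phi psi u : (phi + psi) u = phi u + psi u. Proof. by []. Qed.
Lemma cvN phi u : (- phi) u = - phi u. Proof. by []. Qed.
Lemma cvZ a phi u : (a *: phi) u = a * phi u. Proof. by []. Qed.
Lemma cv0 u : (0 : coverma) u = 0. Proof. by []. Qed.

Ltac cvring := apply/funext => ?; rewrite ?(cvD, cvN, cvZ, cv0); ring.

Lemma opE_linear i : linear (opE i).
Proof. by move=> a x y; apply/funext => u. Qed.
HB.instance Definition _ i :=
  GRing.isLinear.Build C coverma coverma *:%R (opE i) (opE_linear i).

Lemma opH_linear i : linear (opH i).
Proof.
by move=> a x y; apply/funext => u; rewrite /opH !(cvD, cvZ) mulrDr mulrCA.
Qed.
HB.instance Definition _ i :=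
  GRing.isLinear.Build C coverma coverma *:%R (opH i) (opH_linear i).

Lemma opF_linear i : linear (opF i).
Proof.
move=> a x y; apply/funext => u; rewrite cvD cvZ.
elim: u a x y => [|k u IH] a x y /=; first by rewrite mulr0 addr0.
rewrite linearP IH.

case: eqP => _; last by rewrite !addr0.
rewrite linearP /= cvD cvZ; ring.
Qed.
HB.instance Definition _ i :=
  GRing.isLinear.Build C coverma coverma *:%R (opF i) (opF_linear i).

Lemma opEF i j phi :
  opE i (opF j phi) = opF j (opE i phi) + (if i == j then opH j phi else 0).
Proof. by apply/funext => u /=; rewrite /opE /= cvD; case: eqP. Qed.

Lemma word_weight_cons i k u : word_weight i (k :: u) = word_weight i u - A i k.
Proof. by rewrite /word_weight big_cons; ring. Qed.

Lemma opEH i j phi :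
  opE j (opH i phi) = opH i (opE j phi) - (A i j)%:~R *: opE j phi.
Proof.
apply/funext => u; rewrite cvD cvN cvZ /opE /opH word_weight_cons intrB.
by rewrite mulrBl.
Qed.

Lemma opHH i j phi : opH i (opH j phi) = opH j (opH i phi).
Proof. by apply/funext => u; rewrite /opH mulrCA. Qed.

Lemma opHF i j phi :
  opH i (opF j phi) = opF j (opH i phi) - (A i j)%:~R *: opF j phi.
Proof.
apply/funext => u; elim: u phi => [|k u IH] phi.
  by rewrite cvD cvN cvZ /opH /= !mulr0 subr0.
have {IH} := IH (opE k phi); rewrite !(cvD, cvN, cvZ) => IH.
rewrite {1}/opH /= opEH word_weight_cons intrB linearB linearZ /=.
rewrite !(cvD, cvN, cvZ).
move: IH; rewrite {1}/opH.
case: eqP => [->|_] IH; last by rewrite !addr0 mulrBl IH; ring.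
by rewrite /opH mulrBl mulrDr IH; ring.
Qed.

Lemma op_add : (forall i phi psi, opE i (phi + psi) = opE i phi + opE i psi) *
  ((forall i phi psi, opF i (phi + psi) = opF i phi + opF i psi) *
  (forall i phi psi, opH i (phi + psi) = opH i phi + opH i psi)).
Proof. by do !split=> *; rewrite linearD. Qed.

Lemma op_opp : (forall i phi, opE i (- phi) = - opE i phi) *
  ((forall i phi, opF i (- phi) = - opF i phi) *
  (forall i phi, opH i (- phi) = - opH i phi)).
Proof. by do !split=> *; rewrite linearN. Qed.

Lemma op_scale : (forall i a phi, opE i (a *: phi) = a *: opE i phi) *
  ((forall i a phi, opF i (a *: phi) = a *: opF i phi) *
  (forall i a phi, opH i (a *: phi) = a *: opH i phi)).
Proof. by do !split=> *; rewrite linearZ. Qed.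

Lemma op_0 : (forall i, opE i 0 = 0) * ((forall i, opF i 0 = 0) * (forall i, opH i 0 = 0)).
Proof. by do !split=> *; rewrite linear0. Qed.

Definition opL := (op_add, op_opp, op_scale, op_0).

(* On all of [coverma] an operator that commutes with every [opE i] and
   whose values vanish at the empty word is zero: this gives the Serre relations for
   the [opF i] before any finiteness is known. *)
Lemma intertwiner_eq0 (X : coverma -> coverma) :
  (forall phi, X phi [::] = 0) -> (forall i phi, opE i (X phi) = X (opE i phi)) ->
  forall phi, X phi = 0.
Proof.
move=> X0 XE phi; apply/funext => u; rewrite cv0.
elim: u phi => [|i u IH] phi; first exact: X0.
by rewrite -[LHS]/(opE i (X phi) u) XE.
Qed.

Lemma opF_comm i j phi :
  i != j -> A i j = 0 -> opF i (opF j phi) - opF j (opF i phi) = 0.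
Proof.
move=> nij Aij; move: phi.
apply: (intertwiner_eq0 (X := fun phi => opF i (opF j phi) - opF j (opF i phi))).
  by move=> psi; rewrite cvD cvN subr0.
move=> k psi; rewrite !(opL, opEF).
case: (eqVneq k i) => [->|nki].
  by rewrite (negPf nij) ?opL opHF Aij; cvring.
case: (eqVneq k j) => [->|nkj]; last by rewrite ?opL; cvring.
by rewrite ?opL opHF symA Aij; cvring.
Qed.

Lemma opF_serre i j phi : i != j -> A i j = -1 ->
  opF i (opF i (opF j phi)) - 2 *: opF i (opF j (opF i phi)) + opF j (opF i (opF i phi))
  = 0.
Proof.
move=> nij Aij; move: phi.
pose X phi := opF i (opF i (opF j phi)) - 2 *: opF i (opF j (opF i phi))
              + opF j (opF i (opF i phi)).
apply: (intertwiner_eq0 (X := X)) => [psi|k psi]; rewrite {}/X.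
  by rewrite !(cvD, cvN, cvZ) /= mulr0 subr0 addr0.
have Aji : A j i = -1 by rewrite symA.
rewrite !(opL, opEF).
case: (eqVneq k i) => [->|nki].
  rewrite (negPf nij) ?opL !(opHF, opL).
  by rewrite diagA Aij; cvring.
case: (eqVneq k j) => [->|nkj]; last by rewrite ?opL; cvring.
rewrite ?opL !(opHF, opL).
by rewrite Aji; cvring.
Qed.

(** On all of [coverma] the raising operators are free, so their Serre relations can hold only on
    [hwsub]. Each Serre expression commutes with every [opF k] and kills [hwv], hence kills all that
    [hwv] generates; this lemma and the next supply the commutation. *)
Lemma opF_opE_comm i j k phi : i != j -> A i j = 0 ->
  opE i (opE j (opF k phi)) - opE j (opE i (opF k phi)) =
  opF k (opE i (opE j phi) - opE j (opE i phi)).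
Proof.
move=> nij Aij; have Aji : A j i = 0 by rewrite symA.
rewrite !(opL, opEF).
case: (eqVneq j k) => [<-|njk]; first by rewrite (negPf nij) ?opL opEH Aji; cvring.
case: (eqVneq i k) => [<-|nik]; last by rewrite ?opL; cvring.
by rewrite ?opL opEH Aij; cvring.
Qed.

Lemma opF_opE_serre i j k phi : i != j -> A i j = -1 ->
  opE i (opE i (opE j (opF k phi))) - 2 *: opE i (opE j (opE i (opF k phi)))
    + opE j (opE i (opE i (opF k phi))) =
  opF k (opE i (opE i (opE j phi)) - 2 *: opE i (opE j (opE i phi))
    + opE j (opE i (opE i phi))).
Proof.
move=> nij Aij; have Aji : A j i = -1 by rewrite symA.
rewrite !(opL, opEF).
case: (eqVneq j k) => [<-|njk].
  rewrite (negPf nij) ?opL !(opEH, opL).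
  by rewrite Aji; cvring.
case: (eqVneq i k) => [<-|nik]; last by rewrite ?opL; cvring.
rewrite ?opL !(opEH, opL).
by rewrite diagA Aij; cvring.
Qed.

Lemma opE_hwv i : opE i hwv = 0. Proof. by apply/funext. Qed.

Lemma opH_hwv i : opH i hwv = (lam i)%:R *: hwv.
Proof.
apply/funext => -[|k u]; last by rewrite cvZ /opH /hwv /= !mulr0.
by rewrite /opH /word_weight big_nil subr0 pmulrn.
Qed.

(* The submodule generated by [hwv], which will be the irreducible module. *)
Inductive hwsub : coverma -> Prop :=
| hwsub_hwv : hwsub hwv
| hwsub_lin a phi psi : hwsub phi -> hwsub psi -> hwsub (a *: phi + psi)
| hwsub_opF i phi : hwsub phi -> hwsub (opF i phi).

Lemma hwsub0 : hwsub 0.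
Proof. by have := hwsub_lin (-1) hwsub_hwv hwsub_hwv; rewrite scaleN1r addNr. Qed.

Lemma hwsubZ a phi : hwsub phi -> hwsub (a *: phi).
Proof. by move=> h; have := hwsub_lin a h hwsub0; rewrite addr0. Qed.

Lemma hwsubD phi psi : hwsub phi -> hwsub psi -> hwsub (phi + psi).
Proof. by move=> h h'; have := hwsub_lin 1 h h'; rewrite scale1r. Qed.

Lemma hwsub_opH i phi : hwsub phi -> hwsub (opH i phi).
Proof.
elim=> [|a x y _ hx _ hy|j x hx hx'].
- by rewrite opH_hwv; apply/hwsubZ/hwsub_hwv.
- by rewrite linearP; apply: hwsub_lin.
rewrite opHF addrC -scaleNr; apply: hwsub_lin; exact: hwsub_opF.
Qed.

Lemma hwsub_opE i phi : hwsub phi -> hwsub (opE i phi).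
Proof.
elim=> [|a x y _ hx _ hy|j x hx hx'].
- by rewrite opE_hwv; apply: hwsub0.
- by rewrite linearP; apply: hwsub_lin.
rewrite opEF; apply: hwsubD; first exact: hwsub_opF.
by case: eqP => _; [apply: hwsub_opH|apply: hwsub0].
Qed.

Lemma hwsub_eq0 (X : coverma -> coverma) phi : linear X -> X hwv = 0 ->
  (forall i psi, X (opF i psi) = opF i (X psi)) -> hwsub phi -> X phi = 0.
Proof.
move=> linX X0 XF; elim=> [//|a x y _ hx _ hy|i x _ hx].
  by rewrite linX hx hy scaler0 addr0.
by rewrite XF hx linear0.
Qed.

Lemma opE_comm i j phi : i != j -> A i j = 0 -> hwsub phi ->
  opE i (opE j phi) - opE j (opE i phi) = 0.
Proof.
move=> nij Aij.
apply: (hwsub_eq0 (X := fun phi => opE i (opE j phi) - opE j (opE i phi))).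
- by move=> a x y; rewrite !opL; cvring.
- by rewrite !opE_hwv !opL subr0.
- by move=> k psi; apply: opF_opE_comm.
Qed.

Lemma opE_serre i j phi : i != j -> A i j = -1 -> hwsub phi ->
  opE i (opE i (opE j phi)) - 2 *: opE i (opE j (opE i phi)) + opE j (opE i (opE i phi))
  = 0.
Proof.
move=> nij Aij.
apply: (hwsub_eq0 (X := fun phi => opE i (opE i (opE j phi))
   - 2 *: opE i (opE j (opE i phi)) + opE j (opE i (opE i phi)))).
- by move=> a x y; rewrite !opL; cvring.
- by rewrite !opE_hwv !opL scaler0 subr0 addr0.
- by move=> k psi; apply: opF_opE_serre.
Qed.

(** * The grading of functions by weight *)

Definition content u : 'rV[int]_r := \row_k (count_mem k u)%:Z.

Definition wt (b : 'rV[int]_r) i : int := (lam i)%:Z - \sum_k b 0 k * A i k.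

(** Degree [b] means weight [lam] minus the sum of the [b_k alpha_k]. Degrees are integral rather
    than natural, so raising never needs a side condition; the zero function has every degree. *)
Definition homog (b : 'rV[int]_r) phi := forall u, phi u != 0 -> content u = b.

Lemma content_cons k u : content (k :: u) = content u + delta_mx 0 k.
Proof.
apply/rowP => j; rewrite !mxE eqxx /= PoszD addrC; congr (_ + _).
by rewrite (eq_sym k); case: eqP.
Qed.

Lemma content_ge0 u k : 0 <= content u 0 k.
Proof. by rewrite mxE. Qed.

Lemma sum_content u : \sum_k content u 0 k = (size u)%:Z.
Proof.
elim: u => [|i u IH]; first by rewrite big1 // => k _; rewrite mxE.
under eq_bigr do rewrite content_cons mxE.
rewrite big_split IH /= (bigD1 i) //= big1 => [|k nki]; last first.
  by rewrite mxE (negPf nki) andbF.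
by rewrite mxE !eqxx addr0 -addn1 PoszD.
Qed.

Lemma sum_delta i (F : 'I_r -> int) : \sum_k (delta_mx 0 i : 'rV[int]_r) 0 k * F k = F i.
Proof.
rewrite (bigD1 i) //= big1 => [|k nk]; first by rewrite mxE !eqxx mul1r addr0.
by rewrite mxE (negPf nk) andbF mul0r.
Qed.

Lemma wtB b i k m : wt (b - m *: delta_mx 0 k) i = wt b i + m * A i k.
Proof.
rewrite /wt -(sum_delta k (A i)) mulr_sumr -addrA; congr (_ + _).
by rewrite -!sumrN -big_split; apply: eq_bigr => j _; rewrite !mxE /=; ring.
Qed.

Lemma wtB1 b i k : wt (b - delta_mx 0 k) i = wt b i + A i k.
Proof. by rewrite -[delta_mx 0 k]scale1r wtB mul1r. Qed.

Lemma word_weightE i u : word_weight i u = wt (content u) i.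
Proof.
elim: u => [|k u IH].
  rewrite /wt /word_weight big_nil subr0 big1 ?subr0 // => k _.
  by rewrite mxE mul0r.
rewrite word_weight_cons content_cons IH.
by rewrite -[content u in LHS](addrK (delta_mx 0 k)) wtB1 addrK.
Qed.

Lemma homog_hwv : homog 0 hwv.
Proof.
move=> u; rewrite /hwv; case: u => [_|k u /=]; last by rewrite eqxx.
by apply/rowP => k; rewrite !mxE.
Qed.

Lemma homog_opE i b phi : homog b phi -> homog (b - delta_mx 0 i) (opE i phi).
Proof. by move=> h u hu; rewrite -(h _ hu) content_cons addrK. Qed.

Lemma homog_opF i b phi : homog b phi -> homog (b + delta_mx 0 i) (opF i phi).
Proof.
move=> h u; elim: u b phi h => [|k u IH] b phi h /=; first by rewrite eqxx.
rewrite content_cons; have [->|nz _] := eqVneq (opF i (opE k phi) u) 0.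
  rewrite add0r; case: (eqVneq k i) => [->|_]; last by rewrite eqxx.
  by rewrite /opH mulf_eq0 negb_or => /andP[_ /h ->].
by rewrite (IH _ _ (homog_opE (i := k) h) nz) addrAC subrK.
Qed.

Lemma homog_opH i b phi : homog b phi -> opH i phi = (wt b i)%:~R *: phi.
Proof.
move=> h; apply/funext => u; rewrite cvZ /opH.
by have [->|/h <-] := eqVneq (phi u) 0; rewrite ?mulr0 // word_weightE.
Qed.

Lemma homog_iter_opE n i b phi :
  homog b phi -> homog (b - n%:Z *: delta_mx 0 i) (iter n (opE i) phi).
Proof.
move=> h; elim: n => [|n IH]; first by rewrite scale0r subr0.
rewrite iterS -[n.+1]addn1 PoszD scalerDl scale1r opprD addrA; exact: homog_opE.
Qed.

(** Each application of [opE i] lowers the [i]-th coordinate of the degree by one, while contents of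
    words are nonnegative. *)
Lemma homog_opE_nilp i b phi : homog b phi -> exists N, iter N (opE i) phi = 0.
Proof.
move=> h; exists (absz (b 0 i)).+1; apply/funext => u; apply/eqP; rewrite cv0.
apply/negPn/negP => /(homog_iter_opE h)/rowP/(_ i); rewrite !mxE !eqxx mulr1.
by move: (b 0 i : int) => x; lia.
Qed.

Lemma homog_eq0P b phi : homog b phi -> phi <> 0 -> exists2 u, phi u != 0 & content u = b.
Proof.
move=> h nz; apply: contrapT => hn; apply: nz; apply/funext => u; rewrite cv0.
by apply/eqP/negPn/negP => nzu; apply: hn; exists u; rewrite ?(h _ nzu).
Qed.

(** * Strings for the sl2 of one simple root *)

Section SL2.
Variable i : 'I_r.

Lemma iter_op0 n : (iter n (opE i) 0 = 0) * (iter n (opF i) 0 = 0).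
Proof. by elim: n => //= n [-> ->]; rewrite !opL. Qed.

Lemma opH_iter_opE (p : int) phi n : opH i phi = p%:~R *: phi ->
  opH i (iter n (opE i) phi) = (p + n%:Z * 2)%:~R *: iter n (opE i) phi.
Proof.
move=> h; elim: n => [|n IH]; first by rewrite mul0r addr0.
have := opEH i i (iter n (opE i) phi); rewrite IH opL /= => /eqP.
rewrite eq_sym subr_eq -scalerDl => /eqP ->; rewrite diagA -intrD; congr (_%:~R *: _).
by rewrite -[n.+1]addn1 PoszD; ring.
Qed.

Lemma opH_iter_opF (p : int) phi n : opH i phi = p%:~R *: phi ->
  opH i (iter n (opF i) phi) = (p - n%:Z * 2)%:~R *: iter n (opF i) phi.
Proof.
move=> h; elim: n => [|n IH]; first by rewrite mul0r subr0.
rewrite iterS opHF IH opL diagA -scalerBl -intrB; congr (_%:~R *: _).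
by rewrite -[n.+1]addn1 PoszD; ring.
Qed.

Lemma opEi_opFi phi : opE i (opF i phi) = opF i (opE i phi) + opH i phi.
Proof. by rewrite opEF eqxx. Qed.

Lemma iter_opE_opF (p : int) phi n : opH i phi = p%:~R *: phi ->
  iter n.+1 (opE i) (opF i phi) = opF i (iter n.+1 (opE i) phi)
    + (n.+1%:Z * (p + n%:Z))%:~R *: iter n (opE i) phi.
Proof.
move=> h; elim: n => [|n IH].
  by rewrite /= opEi_opFi h mul1r addr0.
rewrite iterS IH !opL /= opEi_opFi -addrA (opH_iter_opE n.+1 h) /= -scalerDl -intrD.
by congr (_ + _%:~R *: _); rewrite -[n.+2]addn1 -[n.+1]addn1 !PoszD; ring.
Qed.

Lemma iter_opF_opE (p : int) phi n : opH i phi = p%:~R *: phi -> opE i phi = 0 ->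
  opE i (iter n.+1 (opF i) phi) = (n.+1%:Z * (p - n%:Z))%:~R *: iter n (opF i) phi.
Proof.
move=> h hE; elim: n => [|n IH].
  by rewrite /= opEi_opFi hE opL add0r h mul1r subr0.
rewrite iterS opEi_opFi IH (opH_iter_opF n.+1 h) opL /= -scalerDl -intrD.
by congr (_%:~R *: _); rewrite -[n.+2]addn1 -[n.+1]addn1 !PoszD; ring.
Qed.

(** When [opF i phi = 0], applying [opF i] to the power [n.+1] of [opE i] on [phi] gives
    [- (n + 1) (p + n)] times the power [n], so vanishing descends from each power to the one
    below. *)
Lemma iter_opE_inj (p : int) phi n : opH i phi = p%:~R *: phi -> opF i phi = 0 ->
  (forall m, (m < n)%N -> p + m%:Z != 0) -> iter n (opE i) phi = 0 -> phi = 0.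
Proof.
move=> h hF; elim: n => [//|n IH] hp h0; apply: IH => [k lt|].
  by apply: hp; apply: ltnW.
have := iter_opE_opF n h; rewrite hF h0 !opL add0r (iter_op0 n.+1).1 => /esym/eqP.
rewrite scaler_eq0 intr_eq0 mulf_eq0 => /orP[/orP[//|]|/eqP //].
by rewrite (negPf (hp n (ltnSn n))).
Qed.

(* Contrapositive: a nonzero vector of weight [p < 0] survives [- p] applications of [opE i],
   which send it to the reflected weight [- p]. *)
Lemma iter_opE_reflect N a (p : int) phi : opH i phi = p%:~R *: phi ->
  iter N (opF i) phi = 0 -> iter a (opE i) phi = 0 -> a%:Z <= - p -> phi = 0.
Proof.
elim: N a p phi => [//|N IH] a p phi h hN ha le_a.
(* The vector [opF i phi] has weight [p - 2], is killed by one power of [opF i] fewer, and by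
   [a + 1] powers of [opE i], so the induction applies to it. Then [phi] is a lowest vector of its
   string, and [p + k < 0] for [k < a]. *)
suff F0 : opF i phi = 0.
  by apply: (iter_opE_inj h F0 _ ha) => k lt; lia.
apply: (IH a.+1 (p - 2)).
- by have := opH_iter_opF 1 h; rewrite mul1r.
- by rewrite -iterSr.
- by rewrite (iter_opE_opF a h) iterS ha !opL scaler0 addr0.
- by lia.
Qed.

End SL2.

(** In a Verma module this vector is singular but nonzero. Here every [opE k] kills it, so it
    vanishes on nonempty words, and no value of [opF i] survives at the empty word. *)
Lemma opF_hwv_nilp i : iter (lam i).+1 (opF i) hwv = 0.
Proof.
apply/funext => -[//|k u].
rewrite -[LHS]/(opE k (iter (lam i).+1 (opF i) hwv) u).
case: (eqVneq k i) => [->|nki].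
  rewrite (iter_opF_opE _ (p := (lam i)%:Z)) ?subrr ?mulr0 ?scale0r ?opE_hwv //.
  by rewrite opH_hwv pmulrn.
suff -> n : opE k (iter n (opF i) hwv) = 0 by [].
elim: n => [|n IH]; first exact: opE_hwv.
by rewrite /= opEF IH (negPf nki) !opL addr0.
Qed.

(** The Serre relations move powers of [opF i] past [opF j] at the cost of at most one power, so
    local nilpotency spreads from [hwv] to all of [hwsub]. *)
Lemma opF_nilp_step i j n phi :
  iter n (opF i) phi = 0 -> iter n.+1 (opF i) (opF j phi) = 0.
Proof.
move=> h0; case: (eqVneq i j) => [<-|nij].
  by rewrite -iterSr !iterS h0 !opL.
case: (offA nij) => Aij.
  have comm psi : opF i (opF j psi) = opF j (opF i psi).
    by apply/eqP; rewrite -subr_eq0 opF_comm.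
  suff -> m : iter m (opF i) (opF j phi) = opF j (iter m (opF i) phi).
    by rewrite iterS h0 !opL.
  by elim: m => //= m ->.
have serre psi : opF i (opF i (opF j psi)) =
    2 *: opF i (opF j (opF i psi)) - opF j (opF i (opF i psi)).
  apply/eqP; rewrite -subr_eq0 -[X in _ == X](opF_serre psi nij Aij).
  by apply/eqP; cvring.
(* Iterating the cubic relation gives [F_i^(m+1) F_j = (m+1) F_i F_j F_i^m - m F_j F_i^(m+1)]. *)
suff -> m : iter m.+1 (opF i) (opF j phi) =
    m.+1%:R *: opF i (opF j (iter m (opF i) phi)) - m%:R *: opF j (iter m.+1 (opF i) phi).
  by rewrite iterS h0 !opL !scaler0 subr0.
elim: m => [|m IH]; first by rewrite scale1r scale0r subr0.
rewrite iterS {}IH !opL serre !iterS -[m.+2]addn1 -[m.+1]addn1 !natrD.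
by cvring.
Qed.

Lemma opF_nilp i phi : hwsub phi -> exists N, iter N (opF i) phi = 0.
Proof.
have iterL n a x y : iter n (opF i) (a *: x + y) =
    a *: iter n (opF i) x + iter n (opF i) y.
  by elim: n => //= n ->; rewrite !opL.
elim=> [|a x y _ [n hn] _ [m hm]|j x _ [n hn]].
- by exists (lam i).+1; apply: opF_hwv_nilp.
- exists (n + m)%N; rewrite iterL [X in _ + X]iterD hm addnC iterD hn.
  by rewrite !iter_op0 scaler0 addr0.
- by exists n.+1; apply: opF_nilp_step.
Qed.

Lemma hwsub_iter_opE n i phi : hwsub phi -> hwsub (iter n (opE i) phi).
Proof. by move=> h; elim: n => // n IH; apply: hwsub_opE. Qed.

(* This sum is [(lam, lam) - (mu, mu)] for [mu] the weight [lam - b]; it is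
   invariant under simple reflections and nonnegative when [mu] is dominant. *)
Lemma weight_norm_le b phi : hwsub phi -> homog b phi -> phi <> 0 ->
  0 <= \sum_k b 0 k * ((lam k)%:Z + wt b k).
Proof.
move=> hs hb /(homog_eq0P hb)[u]; have [n] := ubnP (size u).
elim: n b phi u hs hb => // n IH b phi u hs hb lt_n nz eb.
have [dom|/existsNP[i /negP]] := pselect (forall i, 0 <= wt b i).
  apply: sumr_ge0 => k _; apply: mulr_ge0; last exact: addr_ge0.
    by rewrite -eb content_ge0.
rewrite -ltNge => neg.
have [m em] : exists m : nat, wt b i = - (m.+1)%:Z by exists (absz (wt b i)).-1; lia.
(* The degree of the reflected weight, since the pairing with the coroot is [- (m + 1)]. Words
   become shorter by [m + 1], which drives the induction. *)
pose b' := b - (m.+1)%:Z *: delta_mx 0 i.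
have hb' : homog b' (iter m.+1 (opE i) phi) by apply: homog_iter_opE.
have nz' : iter m.+1 (opE i) phi <> 0.
  have [N hN] := opF_nilp i hs.
  move=> h0; have hp := iter_opE_reflect (homog_opH i hb) hN h0.
  by move: nz; rewrite hp ?cv0 ?eqxx // em opprK.
have [u' nu' eu'] := homog_eq0P hb' nz'.
have su : (size u)%:Z = (size u')%:Z + (m.+1)%:Z.
  rewrite -!sum_content eb eu' -[m.+1%:Z](sum_delta i (fun=> m.+1%:Z)) -big_split.
  by apply: eq_bigr => k _; rewrite !mxE /=; ring.
have := IH b' _ u' (hwsub_iter_opE m.+1 i hs) hb' _ nu' eu'.
have -> : (size u' < n)%N by lia.
move=> /(_ isT); congr (0 <= _).
transitivity (\sum_k (b 0 k * ((lam k)%:Z + wt b k) + b 0 k * (m.+1%:Z * A k i)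
   - (delta_mx 0 i : 'rV[int]_r) 0 k * (m.+1%:Z *
      ((lam k)%:Z + wt b k + m.+1%:Z * A k i)))).
  by apply: eq_bigr => k _; rewrite wtB !mxE /=; ring.
rewrite sumrB sum_delta big_split /= -addrA -[RHS]addr0; congr (_ + _).
have -> : \sum_k b 0 k * (m.+1%:Z * A k i) = m.+1%:Z * ((lam i)%:Z - wt b i).
  rewrite /wt opprB addrCA subrr addr0 mulr_sumr; apply: eq_bigr => k _.
  by rewrite symA; ring.
by rewrite diagA em; ring.
Qed.

Lemma wt_opF_eq0 i b phi : homog b phi -> phi <> 0 -> opF i phi = 0 -> wt b i <= 0.
Proof.
move=> hb nz hF; rewrite leNgt; apply/negP => gt0.
have [N hN] := homog_opE_nilp i hb; apply: nz.
by apply: (iter_opE_inj (homog_opH i hb) hF _ hN) => m _; lia.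
Qed.

(** Lower from [hwv] in directions [i] with [c_i < b_i] as long as the result is nonzero. If stuck
    at degree [c], every such [i] has [wt c i <= 0 <= wt b i], so the quadratic form is at most 0 at
    [b - c], and therefore [c = b]. *)
Lemma dominant_weight_mult_neq0 (b : 'rV[int]_r) :
    (forall c : 'rV[int]_r, \sum_i c 0 i * (\sum_k c 0 k * A i k) <= 0 -> c = 0) ->
    (forall k, 0 <= b 0 k) -> (forall k, 0 <= wt b k) ->
  exists phi, [/\ hwsub phi, homog b phi & phi <> 0].
Proof.
move=> posA b_ge0 dom.
suff H n c phi : hwsub phi -> homog c phi -> phi <> 0 -> (forall k, c 0 k <= b 0 k) ->
    \sum_k (b 0 k - c 0 k) = n%:Z -> exists psi, [/\ hwsub psi, homog b psi & psi <> 0].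
  apply: (H (absz (\sum_k b 0 k)) _ _ hwsub_hwv homog_hwv) => [/(congr1 (@^~ [::]))/eqP|k|].
  - by rewrite cv0 oner_eq0.
  - by rewrite mxE.
  - under eq_bigr do rewrite mxE subr0.
    by rewrite gez0_abs // sumr_ge0.
elim: n c phi => [|n IH] c phi hs hc nz le_cb sn.
  exists phi; split=> //; suff <- : c = b by [].
  apply/rowP => k; apply/eqP; rewrite eq_sym -subr_eq0; apply/eqP.
  move/psumr_eq0P: sn => -> // j _; by rewrite subr_ge0.
have [[i lt_i Fi]|noi] := pselect (exists2 i, c 0 i < b 0 i & opF i phi <> 0).
  apply: (IH (c + delta_mx 0 i) (opF i phi)).
  - exact: hwsub_opF.
  - exact: homog_opF.
  - exact: Fi.
  - move=> k; rewrite !mxE /=; have [->|_] := eqVneq k i; last by rewrite addr0.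
    by move: (c 0 i : int) (b 0 i : int) lt_i => x y; lia.
  transitivity (\sum_k (b 0 k - c 0 k) - \sum_k (delta_mx 0 i : 'rV[int]_r) 0 k * 1).
    by rewrite -sumrB; apply: eq_bigr => k _; rewrite !mxE /=; ring.
  by rewrite sn sum_delta; lia.
suff /eqP : b - c = 0.
  by rewrite subr_eq0 => /eqP ebc; rewrite ebc; exists phi.
apply: posA; apply: sumr_le0 => i _.
have -> : \sum_k (b - c) 0 k * A i k = wt c i - wt b i.
  transitivity (\sum_k b 0 k * A i k - \sum_k c 0 k * A i k); last by rewrite /wt; ring.
  rewrite -sumrB.
  by apply: eq_bigr => k _; rewrite !mxE; ring.
rewrite !mxE; have := le_cb i; rewrite le_eqVlt => /predU1P[->|lt_i].
  by rewrite subrr mul0r.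
rewrite mulr_ge0_le0 ?subr_ge0 ?subr_le0 //; apply: le_trans (dom i).
apply: (wt_opF_eq0 hc nz); apply: contrapT => h.
by apply: noi; exists i.
Qed.

(** * Finite dimension and the irreducible representation on [hwsub] *)

Variable N : nat.
Hypothesis bound : forall b : 'rV[int]_r, (forall k, 0 <= b 0 k) ->
  0 <= \sum_k b 0 k * ((lam k)%:Z + wt b k) -> \sum_k b 0 k <= N%:Z.

Definition wordF w : coverma := foldr opF hwv w.

Lemma hwsub_wordF w : hwsub (wordF w).
Proof. by elim: w => [|i w IH]; [apply: hwsub_hwv|apply: hwsub_opF]. Qed.

Lemma homog_wordF w : homog (content w) (wordF w).
Proof.
elim: w => [|i w IH]; last by rewrite content_cons; apply: homog_opF.
suff -> : content [::] = 0 by apply: homog_hwv.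
by apply/rowP => k; rewrite !mxE.
Qed.

Lemma wordF_neq0_size w u : wordF w u != 0 -> size u = size w /\ (size w <= N)%N.
Proof.
move=> nz; have ec := homog_wordF nz.
have es : size u = size w by apply/eqP; rewrite -eqz_nat -!sum_content ec.
split=> //; rewrite -lez_nat -sum_content; apply: bound => [k|].
  exact: content_ge0.
apply: (weight_norm_le (hwsub_wordF w) (@homog_wordF w)) => h0.
by move: nz; rewrite h0 cv0 eqxx.
Qed.

Lemma wordF_eq0 w : (N < size w)%N -> wordF w = 0.
Proof.
move=> lt; apply/funext => u; rewrite cv0; apply/eqP/negPn/negP => /wordF_neq0_size[_].
by rewrite leqNgt lt.
Qed.

Lemma hwsub_wordF_sum phi : hwsub phi ->
  exists s : seq (C * seq 'I_r), phi = \sum_(x <- s) x.1 *: wordF x.2.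
Proof.
elim=> [|a x y _ [s ->] _ [t ->]|i x _ [s ->]].
- by exists [:: (1, [::])]; rewrite big_seq1 scale1r.
- exists ([seq (a * z.1, z.2) | z <- s] ++ t); rewrite big_cat big_map scaler_sumr.
  by congr (_ + _); apply: eq_bigr => z _; rewrite scalerA.
- exists [seq (z.1, i :: z.2) | z <- s]; rewrite big_map raddf_sum /=.
  by apply: eq_bigr => z _; rewrite opL.
Qed.

(** A representation lives on a [vectType], whereas [coverma] is infinite dimensional. Restricting
    to words of length at most [N] loses nothing on [hwsub], whose members vanish on longer
    words. *)
Definition trunc phi : {ffun N.-bseq 'I_r -> C^o} := [ffun w : N.-bseq 'I_r => phi w].

Definition extend (g : {ffun N.-bseq 'I_r -> C^o}) : coverma :=
  fun u => if insub u is Some w then g w else 0.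

Lemma trunc_linear : linear trunc.
Proof. by move=> a x y; apply/ffunP => w; rewrite !ffunE. Qed.
HB.instance Definition _ := GRing.isLinear.Build C coverma
  {ffun N.-bseq 'I_r -> C^o} *:%R trunc trunc_linear.

Lemma truncZ a phi : trunc (a *: phi) = a *: trunc phi.
Proof. exact: linearZ. Qed.

Lemma extend_linear : linear extend.
Proof.
move=> a x y; apply/funext => u; rewrite cvD cvZ /extend.
by case: insubP => [w _ _|_]; rewrite ?ffunE // mulr0 addr0.
Qed.
HB.instance Definition _ := GRing.isLinear.Build C {ffun N.-bseq 'I_r -> C^o}
  coverma *:%R extend extend_linear.

Lemma extendZ a g : extend (a *: g) = a *: extend g.
Proof. exact: linearZ. Qed.

Lemma extendK : cancel extend trunc.
Proof.
move=> g; apply/ffunP => w; rewrite ffunE /extend.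
by case: insubP => [v _ /val_inj ->|]; rewrite ?size_bseq.
Qed.

Lemma extend_trunc_wordF w : extend (trunc (wordF w)) = wordF w.
Proof.
apply/funext => u; rewrite /extend; case: insubP => [v _ <-|]; first by rewrite ffunE.
move=> /negP hu; apply/esym/eqP/negPn/negP => /wordF_neq0_size[su].
by rewrite -su.
Qed.

Lemma truncK phi : hwsub phi -> extend (trunc phi) = phi.
Proof.
move=> /hwsub_wordF_sum[s ->]; rewrite !raddf_sum /=; apply: eq_bigr => x _.
by rewrite truncZ extendZ extend_trunc_wordF.
Qed.

Definition hwspace : {vspace {ffun N.-bseq 'I_r -> C^o}} :=
  <<[seq trunc (wordF w) | w : N.-bseq 'I_r]>>%VS.

Lemma trunc_hwspace phi : hwsub phi -> trunc phi \in hwspace.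
Proof.
move=> /hwsub_wordF_sum[s ->]; rewrite raddf_sum /=; apply: rpred_sum => x _.
rewrite truncZ; apply: rpredZ; have [lt|le] := ltnP N (size x.2).
  by rewrite wordF_eq0 // linear0 rpred0.
by apply: memv_span; apply/mapP; exists (Bseq le); rewrite ?mem_enum.
Qed.

Lemma hwsub_sum (I : Type) (s : seq I) (P : pred I) (G : I -> coverma) :
  (forall x, P x -> hwsub (G x)) -> hwsub (\sum_(x <- s | P x) G x).
Proof. by move=> h; elim/big_ind: _ => //; [apply: hwsub0|apply: hwsubD]. Qed.

Lemma extend_hwspace g : g \in hwspace -> hwsub (extend g).
Proof.
move=> /coord_span ->; rewrite raddf_sum /=; apply: hwsub_sum => k _.
rewrite extendZ; apply: hwsubZ.
case/mapP: (mem_tnth k (image_tuple (fun w : N.-bseq 'I_r => trunc (wordF w)) predT)) => w _.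
rewrite (tnth_nth 0) => ->.
rewrite extend_trunc_wordF; exact: hwsub_wordF.
Qed.

Definition hwmod : vectType C := subvs_of hwspace.

(** Since [embed] is injective with values in [hwsub], every relation between operators on [hwmod]
    is checked on [coverma]. [reflect_mod] is a section of [embed] over [hwsub] only, so an operator
    transfers once it preserves [hwsub]. *)
Definition embed (x : hwmod) : coverma := extend (vsval x).
Definition reflect_mod phi : hwmod := vsproj hwspace (trunc phi).

Lemma embed_linear : linear embed.
Proof. by move=> a x y; rewrite /embed !linearP. Qed.
HB.instance Definition _ := GRing.isLinear.Build C hwmod coverma *:%R embed embed_linear.

Lemma reflect_mod_linear : linear reflect_mod.
Proof. by move=> a x y; rewrite /reflect_mod !linearP. Qed.
HB.instance Definition _ :=
  GRing.isLinear.Build C coverma hwmod *:%R reflect_mod reflect_mod_linear.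

Lemma hwsub_embed x : hwsub (embed x).
Proof. exact/extend_hwspace/subvsP. Qed.

Lemma reflect_modK phi : hwsub phi -> embed (reflect_mod phi) = phi.
Proof. by move=> h; rewrite /embed vsprojK ?truncK //; apply: trunc_hwspace. Qed.

Lemma embedK : cancel embed reflect_mod.
Proof. by move=> x; rewrite /reflect_mod extendK vsvalK. Qed.

Lemma embed_inj : injective embed. Proof. exact: can_inj embedK. Qed.

Definition restrict_op (X : {linear coverma -> coverma}) : 'End(hwmod) :=
  linfun (reflect_mod \o X \o embed).

Lemma embed_restrict_op (X : {linear coverma -> coverma}) x :
  (forall phi, hwsub phi -> hwsub (X phi)) -> embed (restrict_op X x) = X (embed x).
Proof. by move=> hX; rewrite lfunE /= reflect_modK //; apply/hX/hwsub_embed. Qed.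

Definition hw_e i := restrict_op (opE i).
Definition hw_f i := restrict_op (opF i).
Definition hw_h i := restrict_op (opH i).

Lemma embed_e i x : embed (hw_e i x) = opE i (embed x).
Proof. by apply: embed_restrict_op => phi; apply: hwsub_opE. Qed.
Lemma embed_f i x : embed (hw_f i x) = opF i (embed x).
Proof. by apply: embed_restrict_op => phi; apply: hwsub_opF. Qed.
Lemma embed_h i x : embed (hw_h i x) = opH i (embed x).
Proof. by apply: embed_restrict_op => phi; apply: hwsub_opH. Qed.

Lemma bracketE (V : vectType C) (x y : 'End(V)) v : bracket x y v = x (y v) - y (x v).
Proof. by rewrite add_lfunE opp_lfunE !comp_lfunE. Qed.

Lemma embedB x y : embed (x - y) = embed x - embed y. Proof. exact: linearB. Qed.
Lemma embedZ a x : embed (a *: x) = a *: embed x. Proof. exact: linearZ. Qed.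
Lemma embed0 : embed 0 = 0. Proof. exact: linear0. Qed.

Fact hw_hh i j : bracket (hw_h i) (hw_h j) = 0.
Proof.
apply/lfunP => x; apply: embed_inj; rewrite bracketE zero_lfunE embedB embed0 !embed_h.
by rewrite opHH subrr.
Qed.

Fact hw_ef i j : bracket (hw_e i) (hw_f j) = if i == j then hw_h i else 0.
Proof.
apply/lfunP => x; apply: embed_inj; rewrite bracketE embedB embed_e !embed_f embed_e.
rewrite opEF addrC addKr; case: eqP => [->|_]; first by rewrite embed_h.
by rewrite zero_lfunE embed0.
Qed.

Fact hw_he i j : bracket (hw_h i) (hw_e j) = (A i j)%:~R *: hw_e j.
Proof.
apply/lfunP => x; apply: embed_inj; rewrite bracketE scale_lfunE embedB embedZ.
by rewrite !(embed_e, embed_h) opEH opprB addrCA subrr addr0.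
Qed.

Fact hw_hf i j : bracket (hw_h i) (hw_f j) = - (A i j)%:~R *: hw_f j.
Proof.
apply/lfunP => x; apply: embed_inj; rewrite bracketE scale_lfunE embedB embedZ.
by rewrite !(embed_f, embed_h) opHF addrAC subrr add0r scaleNr.
Qed.

Fact hw_serre_e i j : i != j ->
  iter (absz (1 - A i j)) (bracket (hw_e i)) (hw_e j) = 0.
Proof.
move=> nij; apply/lfunP => x; apply: embed_inj; rewrite zero_lfunE embed0.
case: (offA nij) => Aij; rewrite Aij /=.
  by rewrite bracketE embedB !embed_e opE_comm //; apply: hwsub_embed.
rewrite !bracketE !embedB !embed_e !embedB !embed_e.
rewrite -[RHS](opE_serre nij Aij (hwsub_embed x)) !opL; cvring.
Qed.

Fact hw_serre_f i j : i != j ->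
  iter (absz (1 - A i j)) (bracket (hw_f i)) (hw_f j) = 0.
Proof.
move=> nij; apply/lfunP => x; apply: embed_inj; rewrite zero_lfunE embed0.
case: (offA nij) => Aij; rewrite Aij /=.
  by rewrite bracketE embedB !embed_f opF_comm.
rewrite !bracketE !embedB !embed_f !embedB !embed_f.
rewrite -[RHS](opF_serre (embed x) nij Aij) !opL; cvring.
Qed.

Definition hw_rep : representation C A :=
  Representation hw_hh hw_ef hw_he hw_hf hw_serre_e hw_serre_f.

Lemma mem_weight_space (V : representation C A) (mu : weightQ r) (v : rep_space V) :
  v \in weight_space V mu <-> forall i, rep_h V i v = ratr (mu 0 i) *: v.
Proof.
have mem1 i : (v \in passmx.leigenspace (rep_h V i) (ratr (pairing mu i))) =
    (rep_h V i v == ratr (mu 0 i) *: v).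
  by rewrite memv_ker add_lfunE opp_lfunE scale_lfunE id_lfunE subr_eq0.
split=> [hv i|hv].
  apply/eqP; rewrite -mem1; apply: subvP hv.
  exact: (bigcapv_inf i).
rewrite memvE /weight_space; apply/subv_bigcapP => i _.
by rewrite -memvE mem1 hv.
Qed.

Definition hw_vec : hwmod := reflect_mod hwv.

Lemma embed_hw_vec : embed hw_vec = hwv.
Proof. exact: reflect_modK hwsub_hwv. Qed.

Lemma hw_rep_has_highest_weight : has_highest_weight hw_rep (\row_k (lam k)%:R).
Proof.
exists hw_vec; split.
- apply/eqP => /(congr1 embed); rewrite embed_hw_vec embed0 => /(congr1 (@^~ [::]))/eqP.
  by rewrite cv0 oner_eq0.
- apply/mem_weight_space => i /=; apply: embed_inj.
  by rewrite embed_h embedZ embed_hw_vec opH_hwv mxE ratr_nat.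
- by move=> i /=; apply: embed_inj; rewrite embed_e embed_hw_vec opE_hwv embed0.
Qed.

Lemma hw_rep_weight_space b phi : hwsub phi -> homog b phi -> phi <> 0 ->
  weight_space hw_rep (\row_k (wt b k)%:~R) <> 0%VS.
Proof.
move=> hs hb nz h0; apply: nz.
rewrite -(reflect_modK hs).
have : reflect_mod phi \in weight_space hw_rep (\row_k (wt b k)%:~R).
  apply/mem_weight_space => i /=; apply: embed_inj.
  by rewrite embed_h embedZ reflect_modK // (homog_opH i hb) mxE ratr_int.
by rewrite h0 memv0 => /eqP ->; rewrite embed0.
Qed.

Lemma foldr_opE u phi w : foldr opE phi u w = phi (rev u ++ w).
Proof.
elim: u w => [//|i u IH] w /=.
by rewrite /opE IH rev_cons cat_rcons.
Qed.

Lemma embed_foldr_e u x : embed (foldr hw_e x u) = foldr opE (embed x) u.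
Proof. by elim: u => //= i u <-; rewrite embed_e. Qed.

Lemma embed_foldr_f w : embed (foldr hw_f hw_vec w) = wordF w.
Proof. by elim: w => [|i w IH] /=; rewrite ?embed_hw_vec // embed_f IH. Qed.

Lemma hw_rep_irreducible : irreducible_rep hw_rep.
Proof.
split=> [h0|U stU].
  have : hw_vec \in (fullv : {vspace hwmod}) by rewrite memvf.
  rewrite h0 memv0 => /eqP/(congr1 embed); rewrite embed_hw_vec embed0.
  by move=> /(congr1 (@^~ [::]))/eqP; rewrite cv0 oner_eq0.
have [->|nzU] := eqVneq U 0%VS; [by left|right].
have stE i x : x \in U -> hw_e i x \in U.
  by move=> xU; have [/subvP/(_ _ (memv_img _ xU))] := stU i.
have stF i x : x \in U -> hw_f i x \in U.
  by move=> xU; have [_ /subvP/(_ _ (memv_img _ xU))] := stU i.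
(* Applying the [opE i] along a longest word on which [x] does not vanish
   sends [x] to a nonzero multiple of [hwv]. *)
have vecU : hw_vec \in U.
  pose x := vpick U.
  have nzx : embed x <> 0.
    by rewrite -embed0 => /embed_inj/eqP; rewrite vpick0 (negPf nzU).
  pose P n := `[< exists2 u : seq 'I_r, embed x u != 0 & size u = n >].
  have exP : exists n, P n.
    suff [u nzu] : exists u, embed x u != 0 by exists (size u); apply/asboolP; exists u.
    apply: contrapT => hn; apply: nzx; apply/funext => u; rewrite cv0.
    by apply/eqP/negPn/negP => nzu; apply: hn; exists u.
  have ubP n : P n -> (n <= N)%N.
    move=> /asboolP[u nzu <-]; move: nzu; rewrite /embed /extend.
    by case: insubP => [w //|]; rewrite eqxx.
  have [n /asboolP[u nzu su] maxn] := ex_maxnP exP ubP.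
  have eE : foldr opE (embed x) (rev u) = embed x u *: hwv.
    apply/funext => w; rewrite foldr_opE revK cvZ /hwv.
    case: w => [|k w]; first by rewrite cats0 mulr1.
    rewrite mulr0; apply/eqP/negPn/negP => nzw.
    have := maxn (size (u ++ k :: w)); rewrite size_cat su /= => /(_ _).
    suff -> : P (n + (size w).+1)%N by move=> /(_ isT); rewrite addnS ltnNge leq_addr.
    by apply/asboolP; exists (u ++ k :: w); rewrite ?size_cat ?su.
  have -> : hw_vec = (embed x u)^-1 *: foldr hw_e x (rev u).
    apply: embed_inj; rewrite embedZ embed_foldr_e eE scalerA mulVf // scale1r.
    exact: embed_hw_vec.
  apply: rpredZ; elim: (rev u) => [|k v IH] /=; first exact: memv_pick.
  exact: stE.
have wordU w : foldr hw_f hw_vec w \in U by elim: w => //= k w; apply: stF.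
apply/eqP; rewrite eqEsubv subvf; apply/subvP => y _.
have [s ey] := hwsub_wordF_sum (hwsub_embed y).
suff -> : y = \sum_(z <- s) z.1 *: foldr hw_f hw_vec z.2.
  by apply: rpred_sum => z _; apply: rpredZ.
apply: embed_inj; rewrite ey raddf_sum /=; apply: eq_bigr => z _.
by rewrite embedZ embed_foldr_f.
Qed.

End CoVerma.

(** * Weights of an irreducible module *)

Section WeightsOfRep.
Variables (C : numFieldType) (r : nat) (A : 'M[int]_r) (V : representation C A).
Implicit Types (x y v : rep_space V) (s : seq (rep_space V)).

Definition is_weight_vec (c : 'I_r -> C) x := forall i, rep_h V i x = c i *: x.

Lemma rep_h_span s i x : (forall y, y \in s -> exists c, is_weight_vec c y) ->
  x \in <<s>>%VS -> rep_h V i x \in <<s>>%VS.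
Proof.
move=> hs xs; have /subvP : (rep_h V i @: <<s>> <= <<s>>)%VS; last first.
  by apply; apply: memv_img.
rewrite limg_span; apply/span_subvP => _ /mapP[y ys ->].
by have [c ->] := hs _ ys; apply/rpredZ/memv_span.
Qed.

(** Choose [i] where the weight [c] of the first vector [y] differs from [m]. Then [h_i - c_i] kills
    [y] and multiplies [x] by the nonzero scalar [m_i - c_i], so [x] already lies in the span of the
    other vectors. *)
Lemma weight_vec_span_eq0 s (m : 'I_r -> C) x :
  (forall y, y \in s -> exists c, is_weight_vec c y /\ exists i, c i != m i) ->
  x \in <<s>>%VS -> is_weight_vec m x -> x = 0.
Proof.
elim: s x => [|y s IH] x hs; first by rewrite span_nil memv0 => /eqP.
rewrite span_cons => /memv_addP[_ /vlineP[a ->] [x' x's ->]] hx.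
have [c [hc [i ne]]] := hs y (mem_head _ _).
have hs' z : z \in s -> exists c, is_weight_vec c z /\ exists i, c i != m i.
  by move=> zs; apply: hs; rewrite inE zs orbT.
apply: (IH _ hs') => //.
have /(memvZ (m i - c i)^-1) : rep_h V i x' - c i *: x' \in <<s>>%VS.
  apply: rpredB; last exact: rpredZ.
  by apply: rep_h_span => // z /hs'[d [hd _]]; exists d.
have -> : rep_h V i x' - c i *: x' = (m i - c i) *: (a *: y + x').
  have : rep_h V i (a *: y + x') = a *: (c i *: y) + rep_h V i x'.
    by rewrite linearD linearZ /= hc.
  rewrite hx scalerBl => ->; rewrite scalerDr opprD !scalerA.
  by rewrite [a * _]mulrC addrACA subrr add0r.
by rewrite scalerA mulVf ?scale1r // subr_eq0 eq_sym.
Qed.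

Lemma rep_ef_app i j x :
  rep_e V i (rep_f V j x) = rep_f V j (rep_e V i x) + (if i == j then rep_h V i x else 0).
Proof.
have := congr1 (fun X : 'End(rep_space V) => X x) (rep_ef V i j).
rewrite add_lfunE opp_lfunE !comp_lfunE => /eqP; rewrite subr_eq addrC => /eqP ->.
by case: eqP => // _; rewrite zero_lfunE.
Qed.

Lemma rep_hf_app i j x :
  rep_h V i (rep_f V j x) = rep_f V j (rep_h V i x) - (A i j)%:~R *: rep_f V j x.
Proof.
have := congr1 (fun X : 'End(rep_space V) => X x) (rep_hf V i j).
rewrite add_lfunE opp_lfunE !comp_lfunE scale_lfunE => /eqP.
by rewrite subr_eq addrC scaleNr => /eqP ->.
Qed.

Variables (lam : weightQ r) (v : rep_space V).
Hypothesis nz_v : v != 0.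
Hypothesis wt_v : is_weight_vec (fun i => ratr (lam 0 i)) v.
Hypothesis e_v : forall i, rep_e V i v = 0.

(** Kept as a list so that each member is a weight vector. The spans increase with [n]; [e] and [h]
    preserve each of them and [f] leads into the next, so the span is a submodule once it stops
    growing. *)
Fixpoint lowered n : seq (rep_space V) :=
  if n is n'.+1 then lowered n' ++ [seq rep_f V i y | i <- enum 'I_r, y <- lowered n']
  else [:: v].

Lemma lowered_ind (P : nat -> rep_space V -> Prop) :
  P 0%N v -> (forall n x, x \in lowered n -> P n x -> P n.+1 x) ->
  (forall n i x, x \in lowered n -> P n x -> P n.+1 (rep_f V i x)) ->
  forall n x, x \in lowered n -> P n x.
Proof.
move=> P0 PS PF; elim=> [|n IH] x /=; first by rewrite inE => /eqP ->.
rewrite mem_cat => /orP[hx|/allpairsP[[i y] [_ hy ->]]].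
  exact: (PS _ _ hx (IH _ hx)).
exact: (PF _ _ _ hy (IH _ hy)).
Qed.

Lemma lowered_weight n x : x \in lowered n -> exists b : 'rV[int]_r,
  (forall k, 0 <= b 0 k) /\
  is_weight_vec (fun i => ratr (lam 0 i - \sum_k (b 0 k)%:~R * (A i k)%:~R)) x.
Proof.
apply: (@lowered_ind (fun n x => exists b : 'rV[int]_r, (forall k, 0 <= b 0 k) /\
  is_weight_vec (fun i => ratr (lam 0 i - \sum_k (b 0 k)%:~R * (A i k)%:~R)) x)).
- exists 0; split=> [k|i]; first by rewrite mxE.
  by rewrite wt_v big1 ?subr0 // => k _; rewrite mxE mul0r.
- by [].
move=> {}n i {}x _ [b [b_ge0 hb]]; exists (b + delta_mx 0 i); split=> [k|j].
  by rewrite !mxE addr_ge0.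
rewrite rep_hf_app hb linearZ /= -scalerBl; congr (_ *: _).
rewrite -ratr_int -rmorphB; congr ratr; rewrite -addrA -opprD; congr (_ - _).
transitivity (\sum_k (b 0 k)%:~R * ((A j k)%:~R : rat)
              + \sum_k (k == i)%:R * ((A j k)%:~R : rat)).
  congr (_ + _); rewrite (bigD1 i) //= big1 => [|k /negPf ->]; last by rewrite mul0r.
  by rewrite eqxx mul1r addr0.
rewrite -big_split; apply: eq_bigr => k _.
by rewrite !mxE /= intrD mulrDl; case: eqP.
Qed.

Lemma lowered_e n i x : x \in lowered n -> rep_e V i x \in <<lowered n>>%VS.
Proof.
have subS m y : y \in <<lowered m>>%VS -> y \in <<lowered m.+1>>%VS.
  by apply: subvP; apply: sub_span => z hz; rewrite /= mem_cat hz.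
apply: (@lowered_ind (fun n x => rep_e V i x \in <<lowered n>>%VS)) => [|m y _|m j y hy IH].
- by rewrite e_v rpred0.
- exact: subS.
rewrite rep_ef_app; apply: rpredD.
  have /subvP : (rep_f V j @: <<lowered m>> <= <<lowered m.+1>>)%VS; last first.
    by apply; apply: memv_img.
  rewrite limg_span; apply/span_subvP => _ /mapP[z zs ->]; apply: memv_span.
  by rewrite /= mem_cat; apply/orP; right; apply: allpairs_f; rewrite ?mem_enum.
case: eqP => _; last exact: rpred0.
have [b [_ ->]] := lowered_weight hy.
by apply/rpredZ/subS/memv_span.
Qed.

Lemma lowered_stabilizes : exists n, <<lowered n.+1>>%VS = <<lowered n>>%VS.
Proof.
have sub n : (<<lowered n>> <= <<lowered n.+1>>)%VS.
  by apply: sub_span => z hz; rewrite /= mem_cat hz.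
apply: contrapT => hn.
have lt n : (\dim <<lowered n>> < \dim <<lowered n.+1>>)%N.
  rewrite ltn_neqAle dimvS // andbT; apply/negP => /eqP eqd; apply: hn.
  by exists n; apply/esym/eqP; rewrite eqEdim sub eqd leqnn.
have ge n : (n <= \dim <<lowered n>>)%N.
  by elim: n => // n IH; apply: leq_ltn_trans (lt n).
have := ge (\dim {: rep_space V}).+1.
by rewrite leqNgt ltnS dimvS ?subvf.
Qed.

(** By irreducibility the vectors obtained by lowering [v] span the module. If [mu] differed from
    all their weights, independence of distinct weights would make its weight space zero. *)
Lemma irreducible_weight_le mu : irreducible_rep V -> weight_space V mu <> 0%VS ->
  exists b : 'rV[int]_r, (forall k, 0 <= b 0 k) /\
    forall i, lam 0 i - mu 0 i = \sum_k (b 0 k)%:~R * (A i k)%:~R.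
Proof.
move=> [_ irrV] nz_mu.
have [n stab] := lowered_stabilizes.
have [U0|UT] : <<lowered n>>%VS = 0%VS \/ <<lowered n>>%VS = fullv.
- apply: irrV => i; split; rewrite limg_span; apply/span_subvP => _ /mapP[y ys ->].
  + exact: lowered_e.
  + rewrite -stab; apply: memv_span; rewrite /= mem_cat; apply/orP; right.
    by apply: allpairs_f; rewrite ?mem_enum.
  + by have [b [_ ->]] := lowered_weight ys; apply/rpredZ/memv_span.
- have : v \in <<lowered n>>%VS.
    by apply: memv_span; elim: (n) => [|m IH]; rewrite /= ?inE // mem_cat IH.
  by rewrite U0 memv0 (negPf nz_v).
apply: contrapT => hn; apply: nz_mu; apply/eqP; rewrite -subv0; apply/subvP => x.
move=> /mem_weight_space hx; rewrite memv0; apply/eqP.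
apply: (weight_vec_span_eq0 (s := lowered n) (m := fun i => ratr (mu 0 i))) => //.
  move=> y /lowered_weight[b [b_ge0 hb]]; eexists; split; first exact: hb.
  apply: contrapT => hi; apply: hn; exists b; split=> // i.
  apply/eqP; rewrite subr_eq addrC -subr_eq; apply/negPn/negP => ne; apply: hi.
  by exists i; apply: contra ne => /eqP/fmorph_inj ->.
by rewrite UT memvf.
Qed.
End WeightsOfRep.

(** * The Kostka cone as a polyhedral cone *)

Lemma common_denominator n (f : 'I_n -> rat) :
  exists2 m : nat, (0 < m)%N & forall i, m%:R * f i \is a Num.int.
Proof.
exists (\prod_i absz (denq (f i)))%N.
  by rewrite prodn_gt0 // => i; rewrite absz_gt0 denq_neq0.
move=> i; rewrite (bigD1 i) //= natrM mulrAC; apply: rpredM; last exact: rpred_nat.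
rewrite pmulrn gez0_abs ?denq_ge0 // -[f i in X in _ * X]divq_num_den mulrC divfK.
  exact: intr_int.
by rewrite intr_eq0 denq_neq0.
Qed.

(* [act A b i] is the pairing of [\sum_k b_k alpha_k] with the coroot [alpha_i^vee]. *)
Definition act r (A : 'M[int]_r) (b : 'rV[rat]_r) i : rat := \sum_k b 0 k * (A i k)%:~R.

Record simply_laced r (A : 'M[int]_r) : Prop := SimplyLaced {
  sl_diag : forall i, A i i = 2;
  sl_sym : forall i j, A i j = A j i;
  sl_off : forall i j, i != j -> A i j = 0 \/ A i j = -1;
  sl_pos : forall b : 'rV[rat]_r, b != 0 -> 0 < \sum_i b 0 i * act A b i
}.

Section SimplyLacedTheory.
Variables (r : nat) (A : 'M[int]_r).
Hypothesis slA : simply_laced A.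
Implicit Types (b c : 'rV[rat]_r) (i j k : 'I_r) (I : {set 'I_r}).

Lemma entryB b c i : (b - c) 0 i = b 0 i - c 0 i.
Proof. by rewrite !mxE. Qed.

Lemma actD b c i : act A (b + c) i = act A b i + act A c i.
Proof. by rewrite -big_split; apply: eq_bigr => k _; rewrite mxE mulrDl. Qed.

Lemma actZ a b i : act A (a *: b) i = a * act A b i.
Proof. by rewrite mulr_sumr; apply: eq_bigr => k _; rewrite mxE mulrA. Qed.

Lemma actN b i : act A (- b) i = - act A b i.
Proof. by rewrite -scaleN1r actZ mulN1r. Qed.

Lemma actB b c i : act A (b - c) i = act A b i - act A c i.
Proof. by rewrite actD actN. Qed.

Lemma act0 i : act A 0 i = 0.
Proof. by rewrite -(scale0r (0 : 'rV[rat]_r)) actZ mul0r. Qed.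

Lemma act_sym b c : \sum_i b 0 i * act A c i = \sum_i c 0 i * act A b i.
Proof.
under eq_bigr do rewrite mulr_sumr; rewrite exchange_big; apply: eq_bigr => i _.
rewrite mulr_sumr; apply: eq_bigr => k _.
by rewrite (sl_sym slA) mulrCA.
Qed.

Lemma act_le0_eq0 b : \sum_i b 0 i * act A b i <= 0 -> b = 0.
Proof. by move=> h; apply/eqP/negPn/negP => /(sl_pos slA); rewrite ltNge h. Qed.

Lemma act_block_inv I c : exists2 b : 'rV[rat]_r, forall i, i \notin I -> b 0 i = 0 &
  forall i, i \in I -> act A b i = c 0 i.
Proof.
(* The principal block of the Cartan matrix on [I], padded by the identity outside: one invertible
   matrix solves the system on [I] and forces the solution to vanish elsewhere. *)
pose M : 'M[rat]_r := \matrix_(k, i)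
  if (i \in I) && (k \in I) then (A i k)%:~R else (k == i)%:R.
have ME (b : 'rV[rat]_r) i : (b *m M) 0 i =
    if i \in I then \sum_(k in I) b 0 k * (A i k)%:~R else b 0 i.
  rewrite mxE; case: ifP => iI.
    rewrite [RHS]big_mkcond; apply: eq_bigr => k _; rewrite mxE iI /=.
    case: ifP => // kI; case: eqP => [eki|_]; last by rewrite mulr0.
    by rewrite eki iI in kI.
  rewrite (bigD1 i) //= big1 => [|k nki]; first by rewrite mxE iI eqxx mulr1 addr0.
  by rewrite mxE iI (negPf nki) mulr0.
have actE (b : 'rV[rat]_r) i : (forall k, k \notin I -> b 0 k = 0) ->
    \sum_(k in I) b 0 k * (A i k)%:~R = act A b i.
  move=> hb; rewrite big_mkcond; apply: eq_bigr => k _; case: ifP => // /negbT /hb ->.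
  by rewrite mul0r.
have uM : M \in unitmx.
  rewrite -row_free_unit -kermx_eq0; apply/eqP/row_matrixP => l; rewrite row0.
  set b := row l _; have hb : b *m M = 0 by apply/sub_kermxP/row_sub.
  have b0 i : i \notin I -> b 0 i = 0.
    by move=> iI; have := ME b i; rewrite hb mxE (negPf iI).
  apply: act_le0_eq0; rewrite big1 // => i _; case: (boolP (i \in I)) => [iI|/b0 ->].
    by have := ME b i; rewrite hb mxE iI actE // => <-; rewrite mulr0.
  by rewrite mul0r.
pose d : 'rV[rat]_r := \row_i if i \in I then c 0 i else 0.
pose b := d *m invmx M; have hb : b *m M = d by rewrite mulmxKV.
have b0 i : i \notin I -> b 0 i = 0.
  by move=> iI; have := ME b i; rewrite hb mxE (negPf iI).
exists b => // i iI; by have := ME b i; rewrite hb mxE iI actE // => ->.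
Qed.

Lemma act_surj c : exists b : 'rV[rat]_r, forall i, act A b i = c 0 i.
Proof. by have [b _ hb] := act_block_inv [set: 'I_r] c; exists b => i; rewrite hb ?inE. Qed.

Lemma posdef_int (c : 'rV[int]_r) :
  \sum_i c 0 i * (\sum_k c 0 k * A i k) <= 0 -> c = 0.
Proof.
move=> h; have /rowP z : map_mx (intr : int -> rat) c = 0.
  apply: act_le0_eq0; rewrite -(ler_int rat) in h; apply: le_trans h.
  rewrite raddf_sum le_eqVlt; apply/orP; left; apply/eqP; apply: eq_bigr => i _.
  rewrite /= intrM raddf_sum /= mxE; congr (_ * _); apply: eq_bigr => k _.
  by rewrite mxE intrM.
by apply/rowP => i; have := z i; rewrite !mxE => /eqP; rewrite intr_eq0 => /eqP.
Qed.

Lemma actE_wt (lam : 'I_r -> nat) (b : 'rV[int]_r) i :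
  (wt A lam b i)%:~R = (lam i)%:R - act A (map_mx intr b) i :> rat.
Proof.
rewrite /wt intrB; congr (_ - _); rewrite raddf_sum /=; apply: eq_bigr => k _.
by rewrite mxE intrM.
Qed.

(** Here [z] is [lam + rho] written in simple roots and [c] is its squared norm. The hypothesis
    reads [(b, b) <= 2 (b, lam)]. Adding it to [0 <= (b - z, b - z)] leaves only the contribution of
    [rho], namely [2 * sum b <= c]. *)
Lemma weight_norm_bound (lam : 'I_r -> nat) : exists N : nat, forall b : 'rV[int]_r,
  (forall k, 0 <= b 0 k) -> 0 <= \sum_k b 0 k * ((lam k)%:Z + wt A lam b k) ->
  \sum_k b 0 k <= N%:Z.
Proof.
have [z hz] := act_surj (\row_i ((lam i)%:R + 1)).
pose c := \sum_i z 0 i * act A z i.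
exists (Num.bound c) => b b_ge0; rewrite -(ler_int rat) => hb.
rewrite -(ler_int rat); set x := map_mx (intr : int -> rat) b.
have sq : 0 <= \sum_i (x - z) 0 i * act A (x - z) i.
  by have [->|/(sl_pos slA)/ltW//] := eqVneq (x - z) 0; rewrite big1 // => i _; rewrite mxE mul0r.
have -> : (\sum_k b 0 k)%:~R = \sum_k x 0 k.
  by rewrite raddf_sum; apply: eq_bigr => k _; rewrite mxE.
have eb : (\sum_k b 0 k * ((lam k)%:Z + wt A lam b k))%:~R =
    2 * \sum_k x 0 k * (lam k)%:R - \sum_k x 0 k * act A x k.
  rewrite raddf_sum mulr_sumr -sumrB; apply: eq_bigr => k _ /=.
  by rewrite intrM intrD actE_wt -/x /x mxE -pmulrn; ring.
have ez : \sum_i (x - z) 0 i * act A (x - z) i =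
    \sum_k x 0 k * act A x k - 2 * (\sum_k x 0 k * (lam k)%:R + \sum_k x 0 k) + c.
  transitivity (\sum_k x 0 k * act A x k - 2 * (\sum_k x 0 k * act A z k) + c).
    rewrite mulrDl mul1r {2}(act_sym x z) opprD addrA -!sumrB -big_split /=.
    apply: eq_bigr => k _; rewrite actB.
    rewrite entryB.
    by move: (x 0 k : rat) (z 0 k : rat) (act A x k) (act A z k) => ? ? ? ?; ring.
  congr (_ - _ * _ + _); rewrite -big_split; apply: eq_bigr => k _.
  by rewrite hz [(\row_ _ _) 0 k]mxE mulrDr mulr1.
rewrite eb mulr0z in hb; rewrite ez in sq.
have c_ge0 : 0 <= c.
  rewrite /c; have [->|/(sl_pos slA)/ltW//] := eqVneq z 0.
  by rewrite big1 // => i _; rewrite mxE mul0r.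
have xs_ge0 : 0 <= \sum_k x 0 k by apply: sumr_ge0 => k _; rewrite mxE ler0z.
have := archi_boundP c_ge0; rewrite -pmulrn; lra.
Qed.

End SimplyLacedTheory.

(** The coefficient [b_k] is the pairing of [lam - mu] with the fundamental coweight [x_k], so this
    is the description of the cone by inequalities. *)
Definition dominance_cone r (A : 'M[int]_r) : set (weightQ r * weightQ r) :=
  [set p : weightQ r * weightQ r | [/\ forall i, 0 <= p.1 0 i, forall i, 0 <= p.2 0 i &
     exists2 b : 'rV[rat]_r, (forall k, 0 <= b 0 k) &
       forall i, p.1 0 i - p.2 0 i = act A b i]].

Section KostkaCone.
Variables (R : realType) (r : nat) (A : 'M[int]_r).
Hypothesis slA : simply_laced A.

Lemma kostka_pairs_dominance p : kostka_pairs R A p -> dominance_cone A p.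
Proof.
move=> [dom1 dom2 [V [irrV [v [nz_v wt_v e_v]] nz_mu]]]; split=> [i|i|].
- exact: natr_ge0 (dom1 i).
- exact: natr_ge0 (dom2 i).
have hv : is_weight_vec (fun i => ratr (p.1 0 i)) v by apply/mem_weight_space.
have [b [b_ge0 hb]] := irreducible_weight_le nz_v hv e_v irrV nz_mu.
exists (map_mx intr b) => [k|i]; first by rewrite mxE ler0z.
by rewrite hb; apply: eq_bigr => k _; rewrite mxE.
Qed.

Lemma dominance_cone_lin a p q : 0 <= a -> dominance_cone A p -> dominance_cone A q ->
  dominance_cone A (a *: p + q).
Proof.
move=> a_ge0 [p1 p2 [b b_ge0 hb]] [q1 q2 [c c_ge0 hc]]; split=> [i|i|].
- by rewrite !mxE addr_ge0 // mulr_ge0.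
- by rewrite !mxE addr_ge0 // mulr_ge0.
exists (a *: b + c) => [k|i]; first by rewrite !mxE addr_ge0 // mulr_ge0.
by rewrite actD actZ -hb -hc !mxE; ring.
Qed.

Lemma dominance_cone0 : dominance_cone A 0.
Proof.
split=> [i|i|]; rewrite ?mxE //.
by exists 0 => [k|i]; rewrite ?act0 !mxE ?subrr.
Qed.

Lemma integral_dominance_kostka p (b : 'rV[int]_r) :
    dominant_integral p.1 -> dominant_integral p.2 -> (forall k, 0 <= b 0 k) ->
    (forall i, p.1 0 i - p.2 0 i = act A (map_mx intr b) i) ->
  kostka_pairs R A p.
Proof.
case: p => l m /= dom1 dom2 b_ge0 hb; split=> //=.
pose lam i := Num.truncn (l 0 i).
have lamE i : (lam i)%:R = l 0 i by rewrite /lam truncnK ?dom1.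
have wtE i : m 0 i = (wt A lam b i)%:~R.
  by rewrite actE_wt lamE -hb opprB addrCA subrr addr0.
have [N hN] := weight_norm_bound slA lam.
have [phi [hs hom nz]] : exists phi : coverma R[i] r,
    [/\ hwsub A lam phi, homog b phi & phi <> 0].
  apply: dominant_weight_mult_neq0 => //; try by case: slA.
  - exact: posdef_int.
  - by move=> k; rewrite -(ler_int rat) -wtE; apply: natr_ge0 (dom2 k).
exists (hw_rep R[i] (sl_diag slA) (sl_sym slA) (sl_off slA) hN).
have -> : l = \row_k (lam k)%:R by apply/rowP => k; rewrite mxE lamE.
have -> : m = \row_k (wt A lam b k)%:~R by apply/rowP => k; rewrite mxE wtE.
split; first exact: hw_rep_irreducible.
- exact: hw_rep_has_highest_weight.
- exact: hw_rep_weight_space hom nz.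
Qed.

Lemma kostka_coneE : kostka_cone R A = dominance_cone A.
Proof.
apply/seteqP; split=> [x [n [c [p [hcp ->]]]]|x [x1 x2 [b b_ge0 hb]]].
  elim/big_ind: _ => [|y z hy hz|k _].
  - exact: dominance_cone0.
  - by rewrite -[y]scale1r; apply: dominance_cone_lin.
  - have [c_ge0 /kostka_pairs_dominance hp] := hcp k.
    by rewrite -[_ *: _]addr0; apply: dominance_cone_lin => //; apply: dominance_cone0.
have [m1 m1_gt0 h1] := common_denominator (x.1 0).
have [m2 m2_gt0 h2] := common_denominator (x.2 0).
have [m3 m3_gt0 h3] := common_denominator (b 0).
(* The factor must clear the denominators of [b] as well: integral [lam] and [mu] alone would not
   put [lam - mu] into the root lattice. *)
pose m : rat := (m1 * m2 * m3)%:R.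
have m_gt0 : 0 < m by rewrite ltr0n !muln_gt0 m1_gt0 m2_gt0.
have int1 i : m * x.1 0 i \is a Num.int.
  have -> : m * x.1 0 i = (m2 * m3)%:R * (m1%:R * x.1 0 i) by rewrite /m !natrM; ring.
  by rewrite rpredM ?rpred_nat.
have int2 i : m * x.2 0 i \is a Num.int.
  have -> : m * x.2 0 i = (m1 * m3)%:R * (m2%:R * x.2 0 i) by rewrite /m !natrM; ring.
  by rewrite rpredM ?rpred_nat.
have int3 i : m * b 0 i \is a Num.int.
  have -> : m * b 0 i = (m1 * m2)%:R * (m3%:R * b 0 i) by rewrite /m !natrM; ring.
  by rewrite rpredM ?rpred_nat.
exists 1%N, (fun=> m^-1), (fun=> m *: x); split; last first.
  by rewrite big_ord1 scalerA mulVf ?scale1r // gt_eqF.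
move=> _; split; first by rewrite invr_ge0 ltW.
apply: (@integral_dominance_kostka _ (\row_k Num.floor (m * b 0 k))) => [i|i|k|i].
- by rewrite /pairing natrEint mxE int1 mulr_ge0 // ltW.
- by rewrite /pairing natrEint mxE int2 mulr_ge0 // ltW.
- by rewrite mxE floor_ge0 mulr_ge0 // ltW.
have -> : map_mx intr (\row_k Num.floor (m * b 0 k)) = m *: b.
  by apply/rowP => k; rewrite !mxE floorK.
by rewrite actZ -hb !mxE mulrBr.
Qed.
End KostkaCone.

(** * Extremal rays and connected subdiagrams *)

Lemma small_multiple (T : finType) (a d : T -> rat) :
    (forall i, 0 <= a i) -> (forall i, 0 < d i -> 0 < a i) ->
  exists2 e, 0 < e & forall t, 0 <= t <= e -> forall i, t * d i <= a i.
Proof.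
move=> a_ge0 ad.
suff [e e_gt0 he] : exists2 e, 0 < e &
    forall i, i \in enum T -> forall t, 0 <= t <= e -> t * d i <= a i.
  by exists e => // t ht i; apply: he => //; rewrite mem_enum.
elim: (enum T) => [|i s [e e_gt0 he]]; first by exists 1.
have [d_le0|d_gt0] := lerP (d i) 0.
  exists e => // k; rewrite inE => /predU1P[->|/he//] t /andP[t_ge0 _].
  by apply: le_trans (a_ge0 i); rewrite mulr_ge0_le0.
exists (Num.min e (a i / d i)) => [|k].
  by rewrite lt_min e_gt0 divr_gt0 // ad.
rewrite inE => /predU1P[->|/he h] t; rewrite le_min => /and3P[t_ge0 te td].
  by rewrite -ler_pdivlMr.
by apply: h; rewrite t_ge0.
Qed.

Section ExtremalRays.
Local Open Scope classical_set_scope.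
Local Open Scope card_scope.
Variables (r : nat) (A : 'M[int]_r).
Hypothesis slA : simply_laced A.
Implicit Types (b c l m : 'rV[rat]_r) (i j k : 'I_r) (I J S : {set 'I_r}).

Definition dclosed S J := [forall i in J, forall k in S, (A i k != 0) ==> (k \in J)].

(** The empty set satisfies this vacuously; nonemptiness is imposed separately in the count. *)
Definition dconnected I :=
  [forall J : {set 'I_r}, [&& J != finset.set0, J \subset I & dclosed I J] ==> (J == I)].

Lemma dclosedP S J :
  reflect (forall i k, i \in J -> k \in S -> A i k != 0 -> k \in J) (dclosed S J).
Proof.
apply: (iffP forall_inP) => [h i k iJ kS|h i iJ].
  by move/forall_inP: (h i iJ) => /(_ k kS)/implyP.
by apply/forall_inP => k kS; apply/implyP; apply: h.
Qed.

Lemma dconnectedP I : reflect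
  (forall J, J != finset.set0 -> J \subset I -> dclosed I J -> J = I) (dconnected I).
Proof.
apply: (iffP forallP) => [h J nz sub cl|h J].
  by apply/eqP; apply: (implyP (h J)); rewrite nz sub cl.
by apply/implyP => /and3P[nz sub cl]; apply/eqP/h.
Qed.

(** Take a smallest closed subset of [S] containing [j]. For a closed part [J] of it, either [J] or
    its complement contains [j] and is again closed, by symmetry of [A], so minimality applies. *)
Lemma dcomponent S j : j \in S ->
  exists I, [/\ j \in I, I \subset S, dclosed S I & dconnected I].
Proof.
move=> jS; pose P I := [&& j \in I, I \subset S & dclosed S I].
have PS : P S by rewrite /P jS subxx; apply/dclosedP.
case: (arg_minnP (fun I : {set 'I_r} => #|I|) PS) => I /and3P[jI IS clI] minI.
exists I; split=> //; apply/dconnectedP => J nzJ JI clJ.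
have eq_of_P J' : P J' -> J' \subset I -> J' = I.
  by move=> PJ' J'I; apply/eqP; rewrite eqEcard J'I minI.
case: (boolP (j \in J)) => [jJ|njJ].
  apply: eq_of_P => //; rewrite /P jJ (fintype.subset_trans JI IS); apply/dclosedP => i k iJ kS nz.
  have kI : k \in I by apply: (dclosedP _ _ clI i) => //; apply: (fintype.subsetP JI).
  exact: (dclosedP _ _ clJ i).
have eD : I :\: J = I.
  apply: eq_of_P; last exact: finset.subsetDl.
  rewrite /P finset.in_setD njJ jI (fintype.subset_trans (finset.subsetDl I J) IS).
  apply/dclosedP => i k.
  rewrite !finset.in_setD => /andP[niJ iI] kS nz.
  have kI : k \in I by apply: (dclosedP _ _ clI i).
  rewrite kI andbT; apply: contra niJ => kJ.
  by apply: (dclosedP _ _ clJ k) => //; rewrite (sl_sym slA).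
case/finset.set0Pn: nzJ => i iJ; have := fintype.subsetP JI i iJ.
by rewrite -eD finset.in_setD iJ.
Qed.

Lemma offdiag_le0 i k : i != k -> ((A i k)%:~R : rat) <= 0.
Proof. by move=> /(sl_off slA)[] ->. Qed.

Lemma act_le0 b i : (forall k, 0 <= b 0 k) -> b 0 i = 0 -> act A b i <= 0.
Proof.
move=> b_ge0 bi; apply: sumr_le0 => k _; have [<-|nki] := eqVneq i k.
  by rewrite bi mul0r.
by rewrite mulr_ge0_le0 // offdiag_le0.
Qed.

Lemma act_lt0 b i k : (forall k, 0 <= b 0 k) -> b 0 i = 0 -> b 0 k != 0 -> A i k != 0 ->
  act A b i < 0.
Proof.
move=> b_ge0 bi bk nz; have nik : i != k.
  by apply: contraNneq bk => <-; rewrite bi.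
rewrite /act (bigD1 k) //= ltr_wnDr //.
  apply: sumr_le0 => l _; have [<-|nil] := eqVneq i l; first by rewrite bi mul0r.
  by rewrite mulr_ge0_le0 // offdiag_le0.
rewrite pmulr_rlt0; last by rewrite lt_def bk b_ge0.
by case: (sl_off slA nik) nz => ->.
Qed.

(* The fundamental weight at [j] of the Levi subgroup of type [I], in the basis
   of simple roots. *)
Definition levi_weight I j : 'rV[rat]_r :=
  sval (cid2 (act_block_inv slA I (delta_mx 0 j))).

Lemma levi_weight_out I j i : i \notin I -> levi_weight I j 0 i = 0.
Proof. by rewrite /levi_weight; case: cid2 => b /= h _; apply: h. Qed.

Lemma act_levi_weight I j i : i \in I -> act A (levi_weight I j) i = (i == j)%:R.
Proof. by rewrite /levi_weight; case: cid2 => b /= _ h /h ->; rewrite mxE. Qed.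

(** Let [n] be the negative part of [b], so that [b + n] is the positive part. Then
    [(n, b + n) <= 0] because the supports are disjoint, and [(n, b) >= 0] because [n] lives on [I],
    where [b] pairs nonnegatively. Hence [(n, n) <= 0]. *)
Lemma levi_weight_ge0 I j i : 0 <= levi_weight I j 0 i.
Proof.
set b := levi_weight I j.
pose n : 'rV[rat]_r := \row_k Num.max 0 (- b 0 k).
have n_ge0 k : 0 <= n 0 k by rewrite mxE le_max lexx.
have p_ge0 k : 0 <= (b + n) 0 k.
  by rewrite !mxE /Order.max; case: ltP => h; lra.
suff n0 : n = 0 by have := p_ge0 i; rewrite n0 addr0.
apply: (act_le0_eq0 slA).
have -> : \sum_k n 0 k * act A n k =
    \sum_k n 0 k * act A (b + n) k - \sum_k n 0 k * act A b k.
  by rewrite -sumrB; apply: eq_bigr => k _; rewrite actD; ring.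
rewrite subr_le0; apply: (@le_trans _ _ 0).
  apply: sumr_le0 => k _; have [nk|nk] := eqVneq (n 0 k) 0; first by rewrite nk mul0r.
  rewrite mulr_ge0_le0 // act_le0 //.
  by move: nk; rewrite !mxE /Order.max; case: ltP; [rewrite addrN|rewrite eqxx].
apply: sumr_ge0 => k _; case: (boolP (k \in I)) => kI.
  by rewrite act_levi_weight // mulr_ge0.
by rewrite mxE levi_weight_out // oppr0 maxxx mul0r.
Qed.

(** The support is closed in [I]: a zero coordinate next to a nonzero one would pair negatively with
    its coroot. *)
Lemma levi_weight_neq0 I j i : dconnected I -> j \in I -> (levi_weight I j 0 i != 0) = (i \in I).
Proof.
move=> conI jI; pose J := [set k in I | levi_weight I j 0 k != 0]%SET.
suff eJ : J = I.
  rewrite -[in RHS]eJ inE; apply/idP/andP => [h|[]//]; split=> //.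
  by apply: contraNT h => /levi_weight_out ->.
apply: (dconnectedP _ conI).
- apply: contraTneq isT => J0.
  have b0 : levi_weight I j = 0.
    apply/rowP => k; rewrite [RHS]mxE; apply/eqP/negPn/negP => nz.
    have : k \in J by rewrite inE nz andbT; apply: contraNT nz => /levi_weight_out ->.
    by rewrite J0 inE.
  by have := act_levi_weight j jI; rewrite b0 act0 eqxx => /eqP; rewrite eq_sym oner_eq0.
- by apply/fintype.subsetP => k; rewrite inE => /andP[].
apply/dclosedP => i' k; rewrite !inE => /andP[iI nzi] kI nzA; rewrite kI /=.
apply/negP => /eqP bk; rewrite (sl_sym slA) in nzA.
have := act_lt0 (@levi_weight_ge0 I j) bk nzi nzA.
by rewrite act_levi_weight // ltNge ler0n.
Qed.

Definition ray_gen (x : {set 'I_r} * 'I_r) : weightQ r * weightQ r :=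
  (delta_mx 0 x.2, \row_i ((i == x.2)%:R - act A (levi_weight x.1 x.2) i)).

(** The empty set encodes the diagonal pairs, as [levi_weight] of it is zero; any [j] is allowed
    there. Connectedness makes [I] recoverable from the generator. *)
Definition ray_index : {set {set 'I_r} * 'I_r} :=
  [set x | (x.1 == finset.set0) || (x.2 \in x.1) && dconnected x.1]%SET.

Lemma ray_gen_cone x : dominance_cone A (ray_gen x).
Proof.
case: x => I j; split=> /= [i|i|].
- by rewrite mxE ler0n.
- rewrite mxE; case: (boolP (i \in I)) => iI; first by rewrite act_levi_weight ?subrr.
  rewrite subr_ge0 (@le_trans _ _ 0) ?ler0n // act_le0 ?levi_weight_out //.
  by move=> k; apply: levi_weight_ge0.
by exists (levi_weight I j) => i; [apply: levi_weight_ge0|rewrite !mxE opprB addrCA subrr addr0].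
Qed.

Lemma ray_gen_neq0 x : ray_gen x != 0.
Proof.
apply/eqP => /(congr1 fst)/rowP/(_ x.2)/eqP.
by rewrite !mxE !eqxx oner_eq0.
Qed.

(** On the generator the nonnegative coordinates [lam_i] for [i != j], [mu_i] for [i] in [I] and
    [b_i] for [i] outside [I] are all zero, so they vanish on each summand. Invertibility of the
    block on [I] then leaves [lam_j] as the only parameter. *)
Lemma ray_gen_summand x y z : dominance_cone A y -> dominance_cone A z ->
  ray (ray_gen x) (y + z) -> ray (ray_gen x) y.
Proof.
case: x => I j [y1 y2 [b b_ge0 hb]] [z1 z2 [c c_ge0 hc]] [t t_ge0 eyz].
have e1 i : y.1 0 i + z.1 0 i = t * (i == j)%:R.
  by have /(congr1 fst)/rowP/(_ i) := eyz; rewrite !mxE.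
have e2 i : i \in I -> y.2 0 i = 0.
  move=> iI; have /(congr1 snd)/rowP/(_ i) := eyz.
  rewrite !mxE act_levi_weight // subrr mulr0 => /eqP.
  by rewrite paddr_eq0 // => /andP[/eqP].
have e0 : b + c = t *: levi_weight I j.
  apply/eqP; rewrite -subr_eq0; apply/eqP; apply: (act_le0_eq0 slA).
  rewrite big1 // => i _; suff -> : act A (b + c - t *: levi_weight I j) i = 0.
    by rewrite mulr0.
  rewrite actB actD actZ -hb -hc.
  have /(congr1 snd)/rowP/(_ i) := eyz; rewrite !mxE => /eqP.
  rewrite mulrBr -e1 => /eqP; lra.
have b_out i : i \notin I -> b 0 i = 0.
  move=> iI; have /rowP/(_ i) := e0; rewrite !mxE levi_weight_out // mulr0 => /eqP.
  by rewrite paddr_eq0 // => /andP[/eqP].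
have y1j i : y.1 0 i = y.1 0 j * (i == j)%:R.
  have [->|nij] := eqVneq i j; first by rewrite mulr1.
  by rewrite mulr0; have /eqP := e1 i; rewrite (negPf nij) mulr0 paddr_eq0 // => /andP[/eqP].
have eb : b = y.1 0 j *: levi_weight I j.
  apply/eqP; rewrite -subr_eq0; apply/eqP; apply: (act_le0_eq0 slA).
  rewrite big1 // => i _; case: (boolP (i \in I)) => iI.
    by rewrite actB actZ act_levi_weight // -hb e2 // subr0 (y1j i) subrr mulr0.
  by rewrite entryB b_out // mxE levi_weight_out // mulr0 subrr mul0r.
exists (y.1 0 j) => //; rewrite [LHS]surjective_pairing; congr pair; apply/rowP => i /=.
  by rewrite !mxE (y1j i) eqxx.
have := hb i; rewrite eb actZ (y1j i) !mxE; lra.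
Qed.

Lemma ray_gen_extremal x : extremal_rays (dominance_cone A) (ray (ray_gen x)).
Proof.
split; first by exists (ray_gen x) => //; apply: ray_gen_neq0.
- move=> _ [t t_ge0 ->]; rewrite -[_ *: _]addr0; apply: dominance_cone_lin => //.
    exact: ray_gen_cone.
  exact: dominance_cone0.
move=> y z Ky Kz hyz; split; first exact: ray_gen_summand hyz.
by apply: (@ray_gen_summand _ _ y) => //; rewrite addrC.
Qed.

(** The index [j] is read off from [lam], which also fixes the scale, and [I] is the support of
    [lam - mu] in simple roots. *)
Lemma ray_gen_inj : {in ray_index &, injective (fun x => ray (ray_gen x))}.
Proof.
move=> [I j] [I' j']; rewrite !inE /= => hx hx' eray.
have [t _ et] : ray (ray_gen (I', j')) (ray_gen (I, j)).
  by rewrite -eray; exists 1 => //; rewrite scale1r.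
have ej : j = j'.
  have /(congr1 fst)/rowP/(_ j)/eqP := et; rewrite !mxE !eqxx /=; have [//|_] := eqVneq j j'.
  by rewrite mulr0 oner_eq0.
subst j'; have t1 : t = 1.
  by have /(congr1 fst)/rowP/(_ j) := et; rewrite !mxE !eqxx /= mulr1.
have eb : levi_weight I j = levi_weight I' j.
  apply/eqP; rewrite -subr_eq0; apply/eqP; apply: (act_le0_eq0 slA).
  rewrite big1 // => i _; have /(congr1 snd)/rowP/(_ i) := et.
  by rewrite t1 scale1r !mxE => /addrI/oppr_inj e; rewrite actB e subrr mulr0.
have supp J : (J == finset.set0) || (j \in J) && dconnected J ->
    forall i, (i \in J) = (levi_weight J j 0 i != 0).
  case/orP => [/eqP -> i|/andP[jJ cJ] i]; last by rewrite levi_weight_neq0.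
  by rewrite levi_weight_out inE ?eqxx.
congr pair; apply/finset.setP => i; rewrite (supp I) // (supp I') //.
by rewrite eb.
Qed.

(* If [lam = mu], subtract a multiple of some [(omega_j, omega_j)]; otherwise positive
   definiteness yields [j] with [b_j > 0] and [(b A)_j > 0], and one subtracts the generator
   attached to the component of [j] in the support of [b]. *)
Lemma ray_gen_subtract x : dominance_cone A x -> x != 0 ->
  exists2 y, y \in ray_index & exists2 e, 0 < e & dominance_cone A (x - e *: ray_gen y).
Proof.
case: x => l m [/= l_ge0 m_ge0 [b b_ge0 hb]] nzx.
suff [I [j [hI l_gt0 sub cl mj]]] : exists I j,
  [/\ (I, j) \in ray_index, 0 < l 0 j, forall i, i \in I -> b 0 i != 0,
   forall i k, i \in I -> b 0 k != 0 -> A i k != 0 -> k \in I &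
   I = finset.set0 -> 0 < m 0 j].
  have [e1 e1_gt0 h1] : exists2 e, 0 < e & forall t, 0 <= t <= e ->
      forall i, t * (i == j)%:R <= l 0 i.
    by apply: small_multiple => // i; case: eqP => // ->.
  have [e2 e2_gt0 h2] : exists2 e, 0 < e & forall t, 0 <= t <= e ->
      forall i, t * levi_weight I j 0 i <= b 0 i.
    apply: small_multiple => // i h; rewrite lt_def b_ge0 andbT sub //.
    by apply: contraTT h => /levi_weight_out ->; rewrite ltxx.
  have [e3 e3_gt0 h3] : exists2 e, 0 < e & forall t, 0 <= t <= e ->
      forall i, t * ((i == j)%:R - act A (levi_weight I j) i) <= m 0 i.
    apply: small_multiple => // i.
    case: (boolP (i \in I)) => iI; first by rewrite act_levi_weight // subrr ltxx.
    move: hI; rewrite inE /= => /orP[/eqP I0|/andP[jI _]].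
      have -> : levi_weight I j = 0.
        by apply/rowP => k; rewrite levi_weight_out ?mxE // I0 inE.
      by rewrite act0 subr0; case: eqP => [->|]; rewrite ?ltxx // => _; apply: mj.
    (* Outside [I] the generator has positive [mu_i] only next to [I]. Since [I] is a whole
       component of the support of [b], such an [i] has [b_i = 0], so [b] pairs negatively there and
       [mu_i > lam_i >= 0]. *)
    have /negPf -> : i != j by apply: contraNneq iI => ->.
    rewrite sub0r oppr_gt0 => lw_lt0.
    have [k nzk nzA] : exists2 k, levi_weight I j 0 k != 0 & A i k != 0.
      apply: contrapT => hn; move: lw_lt0; rewrite /act big1 ?ltxx // => k _.
      have [->|nzk] := eqVneq (levi_weight I j 0 k) 0; first by rewrite mul0r.
      have [->|nzA] := eqVneq (A i k) 0; first by rewrite mulr0.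
      by case: hn; exists k.
    have kI : k \in I by apply: contraNT nzk => /levi_weight_out ->.
    have bi : b 0 i = 0.
      apply/eqP; apply: contraNT iI => nzb; apply: (cl k) => //.
      by rewrite (sl_sym slA).
    have := act_lt0 b_ge0 bi (sub k kI) nzA; rewrite -hb subr_lt0.
    exact: le_lt_trans.
  pose e := Num.min e1 (Num.min e2 e3).
  have e_gt0 : 0 < e by rewrite !lt_min e1_gt0 e2_gt0.
  have [le1 le2 le3] : [/\ 0 <= e <= e1, 0 <= e <= e2 & 0 <= e <= e3].
    by rewrite ltW // !ge_min !lexx !orbT.
  exists (I, j) => //; exists e => //; split=> /= [i|i|].
  - by rewrite !mxE eqxx /= subr_ge0 h1.
  - by rewrite !mxE subr_ge0 h3.
  exists (b - e *: levi_weight I j) => i.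
    by rewrite !mxE subr_ge0 h2.
  by rewrite actB actZ -hb !mxE eqxx /=; ring.
have [b0|nzb] := eqVneq b 0.
  have elm i : l 0 i = m 0 i by apply/eqP; rewrite -subr_eq0 hb b0 act0.
  have [j nzj] : exists j, l 0 j != 0.
    apply: contrapT => hn; case/eqP: nzx; congr pair; apply/rowP => i; rewrite mxE.
      by apply/eqP/negPn/negP => h; apply: hn; exists i.
    by rewrite -elm; apply/eqP/negPn/negP => h; apply: hn; exists i.
  have l_gt0 : 0 < l 0 j by rewrite lt_def nzj l_ge0.
  exists finset.set0, j; split=> [||i|i k|_]; rewrite ?inE ?eqxx //.
  by rewrite -elm.
have [j bj aj] : exists2 j, b 0 j != 0 & 0 < act A b j.
  apply: contrapT => hn; have := sl_pos slA nzb; rewrite ltNge => /negP; apply.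
  apply: sumr_le0 => i _; have [->|nzi] := eqVneq (b 0 i) 0; first by rewrite mul0r.
  rewrite mulr_ge0_le0 // leNgt; apply/negP => h.
  by apply: hn; exists i.
pose S := [set i | b 0 i != 0]%SET.
have jS : j \in S by rewrite inE.
have [I [jI IS clI conI]] := dcomponent jS.
exists I, j; split.
- by rewrite inE /= jI conI orbT.
- by move: aj; rewrite -hb subr_gt0; apply: le_lt_trans.
- by move=> i /(fintype.subsetP IS); rewrite inE.
- by move=> i k iI nzk; apply: (dclosedP _ _ clI) => //; rewrite inE.
- by move=> I0; rewrite I0 inE in jI.
Qed.

Lemma extremal_raysE : extremal_rays (dominance_cone A) =
  (fun x => ray (ray_gen x)) @` [set` ray_index].
Proof.
apply/seteqP; split=> [_ [[x nzx ->] sub ext]|_ [x _ <-]]; last exact: ray_gen_extremal.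
have Kx : dominance_cone A x by apply: sub; exists 1 => //; rewrite scale1r.
have [y yT [e e_gt0 Ky]] := ray_gen_subtract Kx nzx.
have Key : dominance_cone A (e *: ray_gen y).
  rewrite -[_ *: _]addr0; apply: dominance_cone_lin (ltW e_gt0) _ _.
    exact: ray_gen_cone.
  exact: dominance_cone0.
have [|[t t_ge0 et] _] := ext _ _ Key Ky.
  by rewrite addrCA subrr addr0; exists 1 => //; rewrite scale1r.
have eg : ray_gen y = (e^-1 * t) *: x.
  by rewrite -scalerA -et scalerA mulVf ?scale1r // gt_eqF.
have t_gt0 : 0 < e^-1 * t.
  rewrite lt_def mulr_ge0 ?invr_ge0 ?(ltW e_gt0) // andbT.
  by apply: contra (ray_gen_neq0 y) => /eqP t0; rewrite eg t0 scale0r.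
exists y => //; apply/seteqP; split=> _ [s s_ge0 ->].
  exists (s * (e^-1 * t)); first exact: mulr_ge0 s_ge0 (ltW t_gt0).
  by rewrite eg scalerA.
exists (s / (e^-1 * t)); first exact: divr_ge0 s_ge0 (ltW t_gt0).
by rewrite eg scalerA mulfVK // gt_eqF.
Qed.

Lemma card_extremal_rays : extremal_rays (dominance_cone A) #= `I_#|ray_index|.
Proof.
rewrite extremal_raysE.
have -> : (fun x => ray (ray_gen x)) @` [set` ray_index] =
    (fun k : 'I_#|ray_index| => ray (ray_gen (enum_val k))) @` [set: 'I_#|ray_index|].
  apply/seteqP; split=> [_ [x /= xT <-]|_ [k _ <-]]; last first.
    by exists (enum_val k) => //=; apply: enum_valP.
  by exists (enum_rank_in xT x) => //; rewrite enum_rankK_in.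
rewrite card_eq_sym; apply: card_eq_trans card_II _; rewrite card_eq_sym.
apply: inj_card_eq => k k' _ _ /ray_gen_inj/enum_val_inj.
by apply; apply: enum_valP.
Qed.
End ExtremalRays.

(** * Counting connected subdiagrams *)

Lemma card_ray_index r (A : 'M[int]_r) :
  #|ray_index A| = (r + \sum_(I : {set 'I_r} | (I != finset.set0) && dconnected A I) #|I|)%N.
Proof.
have -> : #|ray_index A| = (\sum_(I : {set 'I_r})
    (if I == finset.set0 then r else if dconnected A I then #|I| else 0))%N.
  rewrite -sum1_card (eq_bigl (fun x : {set 'I_r} * 'I_r => predT x.1 &&
    ((x.1 == finset.set0) || (x.2 \in x.1) && dconnected A x.1))) => [|x]; last by rewrite inE.
  rewrite -(pair_big_dep predT (fun (I : {set 'I_r}) j => (I == finset.set0) ||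
    (j \in I) && dconnected A I) (fun _ _ => 1%N)) /=.
  apply: eq_bigr => I _; case: eqP => [_|_] /=.
    by rewrite sum1_card card_ord.
  case: ifP => _; last by rewrite big_pred0 // => j; rewrite andbF.
  by rewrite -sum1_card; apply: eq_bigl => j; rewrite andbT.
rewrite (bigD1 finset.set0) //= eqxx; congr (_ + _)%N.
rewrite big_mkcondr; apply: eq_bigr => I /negPf ->; by [].
Qed.

(* [up i k] means that [k] is the parent of [i]; the [wgt i] are the pivots of the elimination
   of the quadratic form from the leaves to the root. *)
Record rooted_tree r (A : 'M[int]_r) (up : rel 'I_r) (ht : 'I_r -> nat)
    (wgt : 'I_r -> rat) : Prop := RootedTree {
  tree_cartan : forall i k, A i k = if i == k then 2 else if up i k || up k i then -1 else 0;
  tree_ht : forall i k, up i k -> (ht k < ht i)%N;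
  tree_parent : forall i k l, up i k -> up i l -> k = l;
  tree_wgt_gt0 : forall i, 0 < wgt i;
  tree_wgt_sum : forall k, wgt k + \sum_(i | up i k) (wgt i)^-1 = 2
}.

Section RootedTree.
Local Open Scope classical_set_scope.
Local Open Scope card_scope.
Variables (r : nat) (A : 'M[int]_r) (up : rel 'I_r) (ht : 'I_r -> nat) (wgt : 'I_r -> rat).
Hypothesis tree : rooted_tree A up ht wgt.
Implicit Types (i j k : 'I_r) (I J : {set 'I_r}).

Lemma up_irr i : up i i = false.
Proof. by apply/negP => /(tree_ht tree); rewrite ltnn. Qed.

Lemma up_asym i k : up i k -> up k i = false.
Proof. by move=> h; apply/negP => /(tree_ht tree); rewrite ltnNge ltnW ?(tree_ht tree). Qed.

Definition tops I := [set i in I | [forall k in I, ~~ up i k]]%SET.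

Lemma topsP I i : reflect (i \in I /\ forall k, k \in I -> ~~ up i k) (i \in tops I).
Proof. by rewrite inE; apply: (iffP andP) => -[iI /forall_inP]. Qed.

Lemma adjE i k : (A i k != 0) = [|| i == k, up i k | up k i].
Proof. by rewrite (tree_cartan tree); case: (i == k) (up i k) (up k i) => [] [] []. Qed.

Lemma min_ht_top I i : i \in I ->
  exists2 t, t \in tops I & forall k, k \in I -> (ht t <= ht k)%N.
Proof.
move=> iI; case: (arg_minnP ht iI) => t tI mint; exists t => //.
apply/topsP; split=> // k kI; apply/negP => /(tree_ht tree).
by rewrite ltnNge mint.
Qed.

(** Each component has its own top. If [I] is connected, the members that climb to a given top
    inside [I] form a closed set, hence all of [I]. Conversely, for a closed part of [I], a member
    of least height in it or in its complement is a top of [I], so a unique top leaves one of the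
    two empty. *)
Lemma dconnected_tops I : (I != finset.set0) && dconnected A I = (#|tops I| == 1%N).
Proof.
apply/andP/cards1P => [[/finset.set0Pn[i0 i0I] /dconnectedP conI]|[t tE]].
  have [t tI _] := min_ht_top i0I; exists t; apply/eqP.
  rewrite finset.eqEsubset finset.sub1set tI andbT.
  apply/fintype.subsetP => t' t'I; rewrite inE.
  have [tI' htop] := topsP _ _ tI; have [t'I' htop'] := topsP _ _ t'I.
  pose e := [rel a b | [&& a \in I, b \in I & up a b]].
  pose J := [set k in I | connect e k t]%SET.
  have head a : connect e a t -> a = t \/ exists2 b, b \in I & up a b /\ connect e b t.
    case/connectP => -[|b p] /= => [_ ->|/andP[/and3P[_ bI ab] pth] et]; [by left|right].
    by exists b => //; split=> //; apply/connectP; exists p.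
  suff eJ : J = I.
    move: t'I'; rewrite -eJ inE => /andP[_ /head[->//|[b bI [ab _]]]].
    by have := htop' b bI; rewrite ab.
  apply: conI.
  - by apply/finset.set0Pn; exists t; rewrite inE tI' connect0.
  - by apply/fintype.subsetP => k; rewrite inE => /andP[].
  apply/dclosedP => i k; rewrite !inE => /andP[iI hi] kI; rewrite kI adjE /=.
  case/or3P => [/eqP <- //|ik|ki].
    case: (head i hi) => [eit|[b bI [ib hb]]]; first by have := htop k kI; rewrite -eit ik.
    by rewrite (tree_parent tree ik ib).
  by apply: connect_trans hi; apply: connect1; rewrite /= kI iI.
have tI : t \in tops I by rewrite tE inE.
split; first by apply/finset.set0Pn; exists t; case/topsP: tI.
apply/dconnectedP => J /finset.set0Pn[i iJ] sJI /dclosedP clJ.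
have tJ : t \in J.
  have [m /topsP[mJ hm] _] := min_ht_top iJ; suff : m \in tops I by rewrite tE inE => /eqP <-.
  apply/topsP; split=> [|k kI]; first exact: (fintype.subsetP sJI).
  apply/negP => mk; have kJ : k \in J by apply: clJ mJ kI _; rewrite adjE mk orbT.
  by have := hm k kJ; rewrite mk.
apply/eqP; rewrite finset.eqEsubset sJI /=; apply/fintype.subsetP => x xI; apply/negPn/negP => nxJ.
have [|m /topsP[]] := @min_ht_top (I :\: J) x; first by rewrite inE nxJ.
rewrite finset.in_setD => /andP[nmJ mI] hm _; suff : m \in tops I.
  by rewrite tE inE => /eqP em; rewrite em tJ in nmJ.
apply/topsP; split=> // k kI; case: (boolP (k \in J)) => kJ.
  by apply: contra nmJ => mk; apply: clJ kJ mI _; rewrite adjE mk !orbT.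
by apply: hm; rewrite inE kJ.
Qed.

(** Completing squares from the leaves gives the form as the sum of [wgt i * (b_i - B_i / wgt i)^2],
    with [B_i] the coordinate at the parent of [i], or 0 at a root. The identity [tree_wgt_sum]
    matches the coefficient 2 of each [b_k^2]. *)
Lemma tree_simply_laced : simply_laced A.
Proof.
have sym i k : A i k = A k i.
  by rewrite !(tree_cartan tree) eq_sym orbC.
split=> [i|//|i k nik|b nzb].
- by rewrite (tree_cartan tree) eqxx.
- by rewrite (tree_cartan tree) (negPf nik); case: ifP; [right|left].
pose B i := \sum_(k | up i k) b 0 k.
have actE i : act A b i = 2 * b 0 i - B i - \sum_(k | up k i) b 0 k.
  rewrite /act (bigD1 i) //= (tree_cartan tree) eqxx mulrC -addrA; congr (_ + _).
  rewrite /B !(big_mkcond (fun k => up _ _)) /= -opprD -big_split -sumrN /=.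
  rewrite (bigD1 (P := predT) i) //= up_irr addr0 oppr0 add0r; apply: eq_bigr => k nki.
  rewrite (tree_cartan tree) eq_sym (negPf nki).
  have [ik|nik] := boolP (up i k); first by rewrite (up_asym ik) /=; ring.
  by case: (up k i) => /=; ring.
have BB i : B i ^+ 2 = \sum_(k | up i k) b 0 k ^+ 2.
  rewrite /B; have [/existsP[k ik]|/existsPn nk] := boolP [exists k, up i k].
    have e1 : up i =1 pred1 k.
      by move=> l; apply/idP/eqP => [il|->//]; apply: (tree_parent tree il ik).
    by rewrite !(eq_bigl _ _ e1) !big_pred1_eq.
  by rewrite !big_pred0 ?expr0n // => k; apply/negbTE.
have eQ : \sum_i b 0 i * act A b i = \sum_i wgt i * (b 0 i - B i / wgt i) ^+ 2.
  have swap (F : 'I_r -> 'I_r -> rat) :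
      \sum_i \sum_(k | up k i) F i k = \sum_i \sum_(k | up i k) F k i.
    by rewrite (exchange_big_dep xpredT).
  transitivity (\sum_i (2 * b 0 i ^+ 2 - 2 * (b 0 i * B i))).
    transitivity (\sum_i (2 * b 0 i ^+ 2 - b 0 i * B i)
        - \sum_i \sum_(k | up k i) b 0 i * b 0 k).
      rewrite -sumrB; apply: eq_bigr => i _; rewrite actE -mulr_sumr; ring.
    rewrite swap -sumrB; apply: eq_bigr => i _.
    under eq_bigr do rewrite mulrC.
    by rewrite -mulr_sumr -/(B i); ring.
  transitivity (\sum_i (wgt i * b 0 i ^+ 2 - 2 * (b 0 i * B i))
      + \sum_i \sum_(k | up i k) b 0 k ^+ 2 / wgt i); last first.
    rewrite -big_split; apply: eq_bigr => i _ /=; rewrite -mulr_suml -BB.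
    by field; apply: lt0r_neq0; apply: (tree_wgt_gt0 tree).
  rewrite -(swap (fun k i => b 0 k ^+ 2 / wgt i)) -big_split; apply: eq_bigr => k _ /=.
  have -> : wgt k = 2 - \sum_(i | up i k) (wgt i)^-1 by rewrite -(tree_wgt_sum tree k) addrK.
  by rewrite -mulr_sumr; ring.
have sq_ge0 i : 0 <= wgt i * (b 0 i - B i / wgt i) ^+ 2.
  by rewrite mulr_ge0 ?sqr_ge0 // ltW // (tree_wgt_gt0 tree).
rewrite eQ lt_def sumr_ge0 // andbT; apply: contra nzb => /eqP/psumr_eq0P h.
(* When all squares vanish, each coordinate is a multiple of the one at its parent, so zero spreads
   from the root upwards in height. *)
suff h0 n i : (ht i < n)%N -> b 0 i = 0.
  by apply/eqP/rowP => i; rewrite mxE (h0 (ht i).+1).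
elim: n i => // n IH i lt_n.
have B0 : B i = 0.
  by apply: big1 => k /(tree_ht tree) lt; apply: IH; apply: leq_trans lt _.
have /eqP := h (fun i _ => sq_ge0 i) i isT.
rewrite B0 mul0r subr0 mulf_eq0 expf_eq0 /= gt_eqF ?(tree_wgt_gt0 tree) //.
by move/eqP.
Qed.

Lemma kostka_rays_tree (R : realType) n :
    (r + \sum_(I : {set 'I_r} | #|tops I| == 1%N) #|I| = n)%N ->
  extremal_rays (kostka_cone R A) #= `I_n.
Proof.
move=> <-; have sl := tree_simply_laced.
rewrite (kostka_coneE R sl) -(eq_bigl _ _ dconnected_tops) -card_ray_index.
exact: card_extremal_rays sl.
Qed.
End RootedTree.

Lemma card_ord_count r (P : pred nat) : #|[set i : 'I_r | P i]%SET| = count P (iota 0 r).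
Proof. by rewrite cardsE -sum1_card -sum1_count -(big_mkord P (fun=> 1%N)) /index_iota subn0. Qed.

(** * Sums over subsets rewritten over boolean lists, ready for evaluation *)

Section MaskSum.
Local Open Scope nat_scope.

Fixpoint masks n : seq bitseq :=
  if n is n'.+1 then [seq b :: m | b <- [:: true; false], m <- masks n'] else [:: [::]].

Lemma mem_masks n m : (m \in masks n) = (size m == n).
Proof.
elim: n m => [|n IH] m; first by rewrite inE; case: m.
apply/allpairsP/idP => [[[b m'] /= [_ hm ->]]|]; first by rewrite eqSS -IH.
case: m => [//|b m]; rewrite eqSS -IH => hm; exists (b, m).
by split=> //=; case: b.
Qed.

Lemma masks_uniq n : uniq (masks n).
Proof.
elim: n => // n IH; apply: allpairs_uniq => // -[b m] [b' m'] _ _ /=.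
by case=> -> ->.
Qed.

Lemma sum_masks n (F : bitseq -> nat) :
  \sum_(I : {set 'I_n}) F (mkseq (fun k => [exists i in I, val i == k]) n) =
  sumn [seq F m | m <- masks n].
Proof.
pose h (I : {set 'I_n}) := mkseq (fun k => [exists i in I, val i == k]) n.
have hE I (i : 'I_n) : nth false (h I) i = (i \in I).
  rewrite nth_mkseq //; apply/exists_inP/idP => [[j jI /eqP/val_inj <-//]|iI].
  by exists i.
have h_inj : injective h.
  by move=> I J e; apply/setP => i; rewrite -!hE e.
rewrite sumnE big_map -(big_map h predT F); apply/perm_big/uniq_perm.
- by rewrite map_inj_uniq // /index_enum -enumT enum_uniq.
- exact: masks_uniq.
move=> m; rewrite mem_masks; apply/mapP/eqP => [[I _ ->]|sm]; first by rewrite size_mkseq.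
exists [set i : 'I_n | nth false m i]; first by rewrite mem_index_enum.
apply: (@eq_from_nth _ false) => [|k]; rewrite sm ?size_mkseq // => lt_k.
by rewrite (hE _ (Ordinal lt_k)) inE.
Qed.

End MaskSum.

(** The root is the end of the long arm, so one list of pivots serves all three ranks: leaves have
    2, the branch node has [2 - 1/2 - 2/3 = 5/6], and each later node has 2 minus the inverse of its
    predecessor. After [1/2] the next pivot would be 0, which is affine [E_8]. *)
Definition wgt_E (F : realFieldType) (i : nat) : F :=
  nth 1 [:: 2; 2; 3 / 2; 5 / 6; 4 / 5; 3 / 4; 2 / 3; 1 / 2] i.

Lemma wgt_E_gt0 (F : realFieldType) i : 0 < wgt_E F i.
Proof. by rewrite /wgt_E; do 8 (case: i => [|i] /=; first by lra); rewrite nth_nil. Qed.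

Lemma wgt_E_sum (F : realFieldType) r k : r \in [:: 6; 7; 8]%N -> (k < r)%N ->
  wgt_E F k + \sum_(0 <= i < r | edge_E i k) (wgt_E F i)^-1 = 2.
Proof.
rewrite !inE unlock => /or3P[] /eqP ->;
  do 8 (case: k => [|k]; first by rewrite /wgt_E /= ?addr0 // => _; field); by [].
Qed.

Section TypeE.
Variable r : nat.

Definition up_E : rel 'I_r := fun i k => edge_E i k.

Lemma tree_E : r \in [:: 6; 7; 8]%N ->
  rooted_tree (cartan_E r) up_E (fun i => r - i)%N (fun i : 'I_r => wgt_E rat i).
Proof.
move=> r678; split=> [i k|[i Hi] [k Hk]|i k l|i|k].
- by rewrite mxE.
- by rewrite /up_E /edge_E /=; lia.
- by rewrite /up_E /edge_E => h h'; apply/val_inj => /=; lia.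
- exact: wgt_E_gt0.
rewrite -(big_mkord (fun i => edge_E i k) (fun i => (wgt_E rat i)^-1)).
exact: wgt_E_sum.
Qed.

(** The inner [count] is the number of tops of the subset encoded by the mask [m]. *)
Definition count_E : nat := sumn [seq (if
   count (fun i => nth false m i && all (fun k => ~~ (edge_E i k && nth false m k)) (iota 0 r))
     (iota 0 r) == 1%N then count id m else 0%N) | m <- masks r].

Lemma count_EE : (\sum_(I : {set 'I_r} | #|tops up_E I| == 1%N) #|I|)%N = count_E.
Proof.
rewrite /count_E -(sum_masks r (fun m => if count (fun i => nth false m i &&
  all (fun k => ~~ (edge_E i k && nth false m k)) (iota 0 r)) (iota 0 r) == 1%N
  then count id m else 0%N)) big_mkcond; apply: eq_bigr => I _.
set m := mkseq _ r.
have mE (i : 'I_r) : nth false m i = (i \in I).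
  rewrite nth_mkseq //; apply/exists_inP/idP => [[j jI /eqP/val_inj <-//]|iI].
  by exists i.
have -> : count id m = #|I|.
  rewrite -[m](mkseq_nth false) size_mkseq /mkseq count_map -card_ord_count.
  by apply: eq_card => i; rewrite inE /= mE.
rewrite -card_ord_count (_ : [set i : 'I_r | _]%SET = tops up_E I) //.
apply/finset.setP => i; rewrite !inE mE; congr (_ && _).
apply/allP/forall_inP => [h k kI|h k].
  by have := h k; rewrite /up_E mem_iota add0n ltn_ord mE kI leq0n !andbT => /(_ isT).
rewrite mem_iota add0n => /andP[_ lt_k]; apply/negP => /andP[ik].
by rewrite (mE (Ordinal lt_k)) => /h; rewrite /up_E /= ik.
Qed.

End TypeE.

Lemma type_E_rays (R : realType) r : r \in [:: 6; 7; 8]%N ->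
  (extremal_rays (kostka_cone R (cartan_E r))
     #= `I_('C(r, 3) + 4 * 'C(r, 2) + 'C(r, 1) - 8))%card.
Proof.
move=> r678; apply: (kostka_rays_tree (tree_E r678)); rewrite count_EE.
by move: r678; rewrite !inE => /or3P[] /eqP ->; vm_compute.
Qed.

Lemma count_itv_iota r a b : (b <= r)%N -> count (fun i => a <= i < b)%N (iota 0 r) = (b - a)%N.
Proof.
move=> le_br; rewrite -sum1_count (_ : iota 0 r = index_iota 0 r); last first.
  by rewrite /index_iota subn0.
rewrite (eq_bigl (fun i => (a <= i)%N && (i < b)%N)) // -(big_nat_widen 0 b r) //.
have [le_ab|lt_ba] := leqP a b.
  rewrite (@big_cat_nat _ _ _ a) //= big_nat_cond big_pred0 => [|i].
    rewrite add0n big_nat_cond (eq_bigl (fun i => a <= i < b)%N) => [|i].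
      by rewrite -big_nat sum_nat_const_nat muln1.
    by apply/andb_idr => /andP[].
  by apply/negbTE; lia.
rewrite big_nat_cond big_pred0 => [|i]; first by lia.
by apply/negbTE; lia.
Qed.

Lemma sum_subr b : (\sum_(0 <= a < b) (b - a) = 'C(b.+1, 2))%N.
Proof.
rewrite -bin2_sum big_nat_rev big_nat_recl // add0n add0n.
by apply: eq_big_nat => a lt_a; lia.
Qed.

Lemma sum_bin2 n : (\sum_(0 <= b < n.+1) 'C(b.+1, 2) = 'C(n.+2, 3))%N.
Proof. by elim: n => [|n IH]; [rewrite big_nat1|rewrite big_nat_recr //= IH -binS]. Qed.

Lemma tops_eq1 r (up : rel 'I_r) (I : {set 'I_r}) t : t \in I ->
    (forall k, k \in I -> ~~ up t k) ->
    (forall i, i \in I -> i != t -> exists2 k, k \in I & up i k) ->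
  tops up I = [set t]%SET.
Proof.
move=> tI ht h; apply/finset.setP => i; rewrite [RHS]inE.
apply/topsP/eqP => [[iI hi]|->//].
by apply/eqP; apply: contraT => /(h i iI)[k kI ik]; have := hi k kI; rewrite ik.
Qed.

(** * Connected subsets of a chain, shared by types A and D *)

Section Chain.
Variables (q n : nat) (up : rel 'I_q.+1).
Hypothesis le_nq : (n <= q.+1)%N.
Hypothesis upE : forall i k : 'I_q.+1, (i < n)%N -> up i k = (i == k.+1 :> nat).
Implicit Types (i k l : 'I_q.+1) (I : {set 'I_q.+1}).

(** Climbing from [i] through predecessors can stop only at the unique top [t], and it visits every
    index in between. *)
Lemma chain_down I t i : tops up I = [set t]%SET -> i \in I -> (i < n)%N ->
  (t <= i)%N /\ forall k, (t <= k <= i)%N -> k \in I.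
Proof.
move=> et; have [m] := ubnP (i : nat); elim: m i => // m IH i lt_im iI lt_in.
have [itop|] := boolP (i \in tops up I).
  move: itop; rewrite et inE => /eqP eit; subst t; split=> // k; rewrite andbC -eqn_leq.
  by move=> /eqP/val_inj ->.
rewrite inE iI /= => /forall_inPn[k kI /negPn]; rewrite upE // => /eqP eik.
have [le_t h] : (t <= k)%N /\ forall l, (t <= l <= k)%N -> l \in I.
  by apply: IH; lia.
split=> [|l /andP[le_tl le_li]]; first by lia.
have [eli|neq] := eqVneq (l : nat) i; first by rewrite (val_inj eli).
by apply: h; lia.
Qed.

Definition chain_itv a b : {set 'I_q.+1} := [set i : 'I_q.+1 | a <= i < b]%N%SET.

Lemma tops_chain_itv a b : (a < b <= n)%N -> tops up (chain_itv a b) = [set inord a]%SET.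
Proof.
move=> ab; have ea : (inord a : 'I_q.+1) = a :> nat by rewrite inordK //; lia.
apply: tops_eq1 => [|k|i]; rewrite ?inE ?ea.
- by lia.
- by move=> hk; rewrite upE ?ea; lia.
move=> hi nia; have {}nia : i != a :> nat.
  by apply: contra nia => /eqP eia; apply/eqP/val_inj; rewrite /= ea.
have ek : (inord i.-1 : 'I_q.+1) = i.-1 :> nat by rewrite inordK //; lia.
by exists (inord i.-1); rewrite ?inE ?upE ?ek; lia.
Qed.

Lemma chain_itvP I : reflect (exists a b, (a < b <= n)%N /\ I = chain_itv a b)
  ((#|tops up I| == 1%N) && [forall i in I, (i < n)%N]).
Proof.
apply: (iffP andP) => [[/cards1P[t et] /forall_inP lt_n]|[a [b [ab ->]]]]; last first.
  rewrite tops_chain_itv // cards1; split=> //; apply/forall_inP => i; rewrite inE.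
  by lia.
have tI : t \in I by have /topsP[] : t \in tops up I by rewrite et inE.
case: (arg_maxnP val tI) => m mI max_m.
have := lt_n m mI => lt_mn.
exists t, m.+1; split; first by have [le_tm _] := chain_down et mI lt_mn; lia.
apply/finset.setP => i; rewrite inE; apply/idP/andP => [iI|[le_ti le_im]].
  by have [le_ti _] := chain_down et iI (lt_n i iI); split=> //; apply: max_m.
have [_ h] := chain_down et mI lt_mn; apply: h; lia.
Qed.

(** The subsets are the intervals from [a] to [b - 1] with [a < b <= n]. Summing [b - a] over [a]
    gives [C(b+1, 2)], and then over [b] the hockey-stick identity applies. *)
Lemma sum_chain :
  (\sum_(I : {set 'I_q.+1} | (#|tops up I| == 1) && [forall i in I, (i < n)%N]) #|I|
   = 'C(n.+2, 3))%N.
Proof.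
pose D : {set 'I_n.+1 * 'I_n.+1} := [set p : 'I_n.+1 * 'I_n.+1 | (p.2 < p.1)%N]%SET.
pose h (p : 'I_n.+1 * 'I_n.+1) := chain_itv p.2 p.1.
have hinj : {in D &, injective h}.
  move=> [b a] [b' a']; rewrite !inE /= => ab ab' /finset.setP e.
  have mem (k : nat) : (k < q.+1)%N -> (a <= k < b)%N = (a' <= k < b')%N.
    by move=> lt_k; have := e (Ordinal lt_k); rewrite !inE.
  have lt_b := ltn_ord b; have lt_b' := ltn_ord b'.
  have h1 := mem a; have h2 := mem a'; have h3 := mem b.-1; have h4 := mem b'.-1.
  by congr pair; apply/val_inj => /=; lia.
rewrite (eq_bigl (fun I => I \in [set h p | p in D]%SET)) => [|I]; last first.
  apply/chain_itvP/imsetP => [[a [b [ab ->]]]|[[b a]]].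
    have lt_b : (b < n.+1)%N by lia.
    have lt_a : (a < n.+1)%N by lia.
    by exists (Ordinal lt_b, Ordinal lt_a) => //; rewrite inE /=; lia.
  rewrite inE /= => ab ->; exists a, b; split=> //.
  by have := ltn_ord b; lia.
rewrite (big_imset _ hinj) /=.
rewrite (eq_bigl (fun p : 'I_n.+1 * 'I_n.+1 => predT p.1 && (p.2 < p.1)%N)); last first.
  by move=> p; rewrite inE.
rewrite -(pair_big_dep predT (fun b a : 'I_n.+1 => (a < b)%N)
  (fun b a : 'I_n.+1 => #|chain_itv a b|)) /=.
rewrite -sum_bin2 [RHS]big_mkord; apply: eq_bigr => b _.
rewrite -sum_subr (big_nat_widen 0 b n.+1) /=; last by apply: ltnW.
rewrite [RHS]big_mkord; apply: eq_bigr => a _.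
rewrite /chain_itv (card_ord_count q.+1 (fun j : nat => a <= j < b)%N) count_itv_iota //.
by have := ltn_ord b; lia.
Qed.

End Chain.

(** * Type A: a chain rooted at its first node *)

Section TypeA.
Variable q : nat.
Local Notation r := q.+1.

Definition up_A : rel 'I_r := fun i k => edge_A k i.

(** With [m = r - i], the ratio [(m + 1) / m] of the Cartan determinants of [A_m] and [A_(m-1)]. *)
Definition wgt_A (F : realFieldType) (i : nat) : F := (r - i).+1%:R / (r - i)%:R.

Lemma tree_A : rooted_tree (cartan_A r) up_A (fun i => i : nat) (fun i : 'I_r => wgt_A rat i).
Proof.
split=> [i k|i k|i k l|i|k].
- by rewrite mxE orbC.
- by rewrite /up_A /edge_A => /eqP ->.
- by rewrite /up_A /edge_A => h h'; apply/val_inj => /=; lia.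
- by rewrite divr_gt0 // ltr0n subn_gt0.
have lt_k := ltn_ord k; rewrite /wgt_A /up_A /edge_A.
have [lt_k1|ge_k1] := ltnP k.+1 r.
  rewrite (big_pred1 (Ordinal lt_k1)) => [|i] /=.
    have -> : (r - k = (r - k.+1).+1)%N by lia.
    have : (0 < r - k.+1)%N by lia.
    case: (r - k.+1)%N => // m _; rewrite invf_div -mulrDl -natrD.
    have -> : (m.+3 + m.+1 = 2 * m.+2)%N by lia.
    by rewrite natrM mulfK ?pnatr_eq0.
  by apply/eqP/eqP => [e|->//]; apply/val_inj.
rewrite big_pred0 => [|i]; last by have := ltn_ord i; lia.
have -> : (r - k = 1)%N by lia.
by rewrite addr0 divr1.
Qed.

End TypeA.

Lemma type_A_rays (R : realType) r : (1 <= r)%N ->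
  (extremal_rays (kostka_cone R (cartan_A r))
     #= `I_('C(r.+1, 3) + 'C(r.+1, 2) + 'C(r.+1, 1) - 1))%card.
Proof.
case: r => // q _; apply: (kostka_rays_tree (tree_A q)).
rewrite (eq_bigl (fun I => (#|tops (@up_A q) I| == 1%N) && [forall i in I, (i < q.+1)%N])).
  rewrite sum_chain //.
  by rewrite (binS q.+2 2) bin1; lia.
move=> I /=; rewrite -[LHS]andbT; congr (_ && _); apply/esym/forall_inP => i _.
exact: ltn_ord.
Qed.

(** * Type D: a chain of [n] nodes and one more node attached at [n - 2] *)

Section TypeD.
Variable n : nat.
Hypothesis ge3 : (3 <= n)%N.
Local Notation r := n.+1.
Implicit Types (i k : 'I_r) (I : {set 'I_r}).

Definition up_D : rel 'I_r := fun i k => edge_D r k i.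

(** The two leaves have pivot 2, so the branch node has [2 - 1/2 - 1/2 = 1], and this value
    reproduces itself along the chain. *)
Definition wgt_D (F : realFieldType) (i : nat) : F := if (i < n.-1)%N then 1 else 2.

Lemma up_DE i k :
  up_D i k = (i < n)%N && (i == k.+1 :> nat) || (i == n :> nat) && (k == n - 2 :> nat)%N.
Proof. by have := ltn_ord i; rewrite /up_D /edge_D; lia. Qed.

Lemma tree_D : rooted_tree (cartan_D r) up_D (fun i => i : nat) (fun i => wgt_D rat i).
Proof.
split=> [i k|i k|i k l|i|k].
- by rewrite mxE orbC.
- by rewrite up_DE; lia.
- by rewrite !up_DE => h h'; apply/val_inj => /=; lia.
- by rewrite /wgt_D; case: ifP.
have lt_k := ltn_ord k; have lt_n : (n < r)%N by [].
have [lt_k1|ge_k1] := ltnP k n.-1; last first.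
  rewrite big_pred0 => [|i]; last by have := ltn_ord i; rewrite up_DE; lia.
  by rewrite addr0 /wgt_D ltnNge ge_k1.
have lt_k1r : (k.+1 < r)%N by lia.
have [ek|nk] := eqVneq (k : nat) (n - 2)%N.
  rewrite (bigD1 (Ordinal lt_k1r)) /=; last by rewrite up_DE /=; lia.
  rewrite (big_pred1 (Ordinal lt_n)) => [|i]; last first.
    rewrite /= up_DE -!(inj_eq val_inj) /=; have := ltn_ord i; lia.
  rewrite /wgt_D lt_k1 /= ifF; last by lia.
  by rewrite ifF; [lra|lia].
rewrite (big_pred1 (Ordinal lt_k1r)) => [|i]; last first.
  rewrite up_DE; apply/idP/eqP => [h|->] /=; last by lia.
  by apply/val_inj => /=; lia.
rewrite /wgt_D lt_k1 /= ifT; last by lia.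
by rewrite invr1.
Qed.

(** For [a = n.-1] the interval is empty and the hook is the single node [n]; hence the case
    distinction on its top. *)
Definition hook a : {set 'I_r} := [set i : 'I_r | (a <= i < n.-1)%N || (i == n :> nat)]%SET.
Definition fork a : {set 'I_r} := [set i : 'I_r | (a <= i < n.+1)%N]%SET.

Lemma card_hook a : (a < n)%N -> #|hook a| = (n - a)%N.
Proof.
move=> lt_an; rewrite /hook (card_ord_count _ (fun j : nat => (a <= j < n.-1) || (j == n))%N).
rewrite -addn1 iotaD count_cat /= eqxx orbT.
have -> : count (fun j : nat => (a <= j < n.-1) || (j == n))%N (iota 0 n) =
    count (fun j : nat => a <= j < n.-1)%N (iota 0 n).
  by apply: eq_in_count => j; rewrite mem_iota; lia.
by rewrite count_itv_iota; lia.
Qed.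

Lemma card_fork a : #|fork a| = (n.+1 - a)%N.
Proof. by rewrite (card_ord_count _ (fun j : nat => a <= j < n.+1)%N) count_itv_iota. Qed.

Lemma tops_hook a : (a < n)%N ->
  tops up_D (hook a) = [set inord (if a == n.-1 then n else a)]%SET.
Proof.
move=> lt_an; set t := if _ then _ else _.
have ht : a = n.-1 /\ t = n \/ (a < n.-1)%N /\ t = a.
  by rewrite /t; case: eqP => h; [left|right; lia].
have et : (inord t : 'I_r) = t :> nat by rewrite inordK //; lia.
clearbody t; apply: tops_eq1 => [|k|i]; rewrite ?inE ?et.
- by lia.
- by rewrite up_DE et; lia.
move=> hi nit; have {}nit : i != t :> nat.
  by apply: contra nit => /eqP eit; apply/eqP/val_inj; rewrite /= et.
have [k hk] : exists k : 'I_r, k = (if i == n :> nat then n - 2 else i.-1)%N :> nat.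
  by eexists (inord _); rewrite inordK //; have := ltn_ord i; case: ifP; lia.
by exists k; rewrite ?inE ?up_DE; move: hk; have := ltn_ord i; case: ifP; lia.
Qed.

Lemma tops_fork a : (a < n.-1)%N -> tops up_D (fork a) = [set inord a]%SET.
Proof.
move=> lt_an; have et : (inord a : 'I_r) = a :> nat by rewrite inordK //; lia.
apply: tops_eq1 => [|k|i]; rewrite ?inE ?et.
- by lia.
- by rewrite up_DE et; lia.
move=> hi nit; have {}nit : i != a :> nat.
  by apply: contra nit => /eqP eit; apply/eqP/val_inj; rewrite /= et.
have [k hk] : exists k : 'I_r, k = (if i == n :> nat then n - 2 else i.-1)%N :> nat.
  by eexists (inord _); rewrite inordK //; have := ltn_ord i; case: ifP; lia.
by exists k; rewrite ?inE ?up_DE; move: hk; have := ltn_ord i; case: ifP; lia.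
Qed.

Let chainD i k : (i < n)%N -> up_D i k = (i == k.+1 :> nat).
Proof. by rewrite up_DE; lia. Qed.

Let le_n : (n <= r)%N := leqnSn n.

Let n1 : 'I_r := inord n.-1.
Let n1E : n1 = n.-1 :> nat. Proof. by rewrite inordK //; lia. Qed.

(** Unless [ord_max] is itself the top, its parent [n - 2] lies in [I], and [chain_down] from there
    fills the interval starting at [t]. Only the membership of [n - 1] is then left open. *)
Lemma connected_last I t : tops up_D I = [set t]%SET -> ord_max \in I ->
  if n1 \in I then (t < n.-1)%N /\ I = fork t
  else exists2 a, (a < n)%N & I = hook a.
Proof.
move=> et maxI.
have par i : i \in I -> i != t -> exists2 k, k \in I & up_D i k.
  move=> iI nit; apply: contrapT => hn; case/eqP: nit.
  suff : i \in tops up_D I by rewrite et inE => /eqP.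
  by apply/topsP; split=> // k kI; apply/negP => ik; apply: hn; exists k.
have down i := chain_down le_n chainD et (i := i).
have max_t : ord_max != t -> (t <= n - 2)%N /\ forall k, (t <= k <= n - 2)%N -> k \in I.
  move=> /(par _ maxI)[k kI]; rewrite up_DE /= ltnn /= eqxx => /eqP ek.
  by rewrite -ek; apply: down => //; lia.
have nmax i : i \in I -> i != ord_max -> (i < n)%N.
  move=> _; rewrite -(inj_eq val_inj) /=; have := ltn_ord i; lia.
case: ifP => n1I.
  have [le_t1 ht1] := down n1 n1I ltac:(lia).
  have [|le_t ht] := max_t; first by rewrite -(inj_eq val_inj) /=; lia.
  split; first by lia.
  apply/finset.setP => i; rewrite inE; apply/idP/idP => [iI|hi].
    have [->|ni] := eqVneq i ord_max; first by rewrite /=; lia.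
    by have [le_ti _] := down i iI (nmax i iI ni); rewrite le_ti ltn_ord.
  have [->//|ni] := eqVneq i ord_max.
  by apply: ht1; move: ni; rewrite -(inj_eq val_inj) /=; lia.
have [et'|nt] := eqVneq ord_max t.
  exists n.-1; first by lia.
  apply/finset.setP => i; rewrite inE.
  have [->|ni] := eqVneq i ord_max; first by rewrite maxI /= eqxx orbT.
  apply/idP/idP => [iI|]; last by move: ni; rewrite -(inj_eq val_inj) /=; lia.
  have [le_ti _] := down i iI (nmax i iI ni).
  by move: le_ti (nmax i iI ni); rewrite -et' /=; lia.
have [le_t ht] := max_t nt.
exists t; first by lia.
apply/finset.setP => i; rewrite inE.
have [->|ni] := eqVneq i ord_max; first by rewrite maxI /= eqxx orbT.
apply/idP/idP => [iI|hi].
  have [le_ti _] := down i iI (nmax i iI ni); have lt_in := nmax i iI ni.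
  have : i != n1 by apply: contraFneq n1I => <-.
  by rewrite -(inj_eq val_inj) /= n1E; lia.
by apply: ht; move: ni; rewrite -(inj_eq val_inj) /=; lia.
Qed.

Lemma sum_hook : (\sum_(I : {set 'I_r} | (#|tops up_D I| == 1) && (ord_max \in I)
  && (n1 \notin I)) #|I| = 'C(n.+1, 2))%N.
Proof.
pose h (a : 'I_n) := hook a.
have hinj : {in [set: 'I_n]%SET &, injective h}.
  move=> a a' _ _ /finset.setP e; apply/val_inj => /=.
  have mem (k : nat) : (k < n.+1)%N ->
      ((a <= k < n.-1) || (k == n))%N = ((a' <= k < n.-1) || (k == n))%N.
    by move=> lt_k; have := e (Ordinal lt_k); rewrite !inE.
  have lt_a := ltn_ord a; have lt_a' := ltn_ord a'.
  by have h1 := mem a; have h2 := mem a'; lia.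
rewrite (eq_bigl (fun I => I \in [set h a | a in [set: 'I_n]%SET]%SET)) => [|I]; last first.
  apply/andP/imsetP => [[/andP[/cards1P[t et] maxI] n1I]|[a _ ->]].
    have := connected_last et maxI; rewrite (negPf n1I) => -[a lt_a ->].
    by exists (Ordinal lt_a); rewrite ?inE.
  rewrite tops_hook // cards1 !inE /= n1E eqxx orbT.
  by split=> //; lia.
rewrite (big_imset _ hinj) /= -sum_subr big_mkord.
by apply: eq_big => [a|a _]; rewrite ?inE ?card_hook.
Qed.

(** The sizes [n + 1 - a] would add up to [C(n+2, 2)] over all [a <= n]. The values [a = n - 1] and
    [a = n] are excluded, and their sizes 2 and 1 make up the 3. *)
Lemma sum_fork : (\sum_(I : {set 'I_r} | (#|tops up_D I| == 1) && (ord_max \in I)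
  && (n1 \in I)) #|I| + 3 = 'C(n.+2, 2))%N.
Proof.
pose h (a : 'I_n.-1) := fork a.
have hinj : {in [set: 'I_n.-1]%SET &, injective h}.
  move=> a a' _ _ /finset.setP e; apply/val_inj => /=.
  have mem (k : nat) : (k < n.+1)%N -> (a <= k < n.+1)%N = (a' <= k < n.+1)%N.
    by move=> lt_k; have := e (Ordinal lt_k); rewrite !inE.
  have lt_a := ltn_ord a; have lt_a' := ltn_ord a'.
  by have h1 := mem a; have h2 := mem a'; lia.
rewrite (eq_bigl (fun I => I \in [set h a | a in [set: 'I_n.-1]%SET]%SET)) => [|I]; last first.
  apply/andP/imsetP => [[/andP[/cards1P[t et] maxI] n1I]|[a _ ->]].
    have := connected_last et maxI; rewrite n1I => -[lt_t ->].
    by exists (Ordinal lt_t); rewrite ?inE.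
  rewrite tops_fork // cards1 !inE /= n1E; have := ltn_ord a.
  by split; lia.
rewrite (big_imset _ hinj) /= -sum_subr.
rewrite (eq_bigl predT) => [|a]; last by rewrite inE.
under eq_bigr do rewrite /h card_fork.
rewrite -(big_mkord predT (fun a => n.+1 - a)%N) /=.
have last2 (F : nat -> nat) : (\sum_(0 <= a < n.+1) F a =
    \sum_(0 <= a < n.-1) F a + F n.-1 + F n)%N.
  by case: (n) ge3 => // m _; rewrite !big_nat_recr.
by rewrite last2; lia.
Qed.

Lemma sum_D : (\sum_(I : {set 'I_r} | #|tops up_D I| == 1%N) #|I| + 3
  = 'C(n.+2, 3) + 'C(n.+1, 2) + 'C(n.+2, 2))%N.
Proof.
rewrite (bigID (fun I : {set 'I_r} => ord_max \in I)) /=.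
rewrite (bigID (fun I : {set 'I_r} => n1 \in I)) /= sum_hook.
rewrite (eq_bigl (fun I => (#|tops up_D I| == 1%N) && [forall i in I, (i < n)%N])
  (P1 := fun I => _ && (_ \notin _))) => [|I]; last first.
  congr (_ && _); apply/idP/forall_inP => [nmax i iI|h]; last first.
    by apply/negP => /h; rewrite ltnn.
  have : i != ord_max by apply: contraNneq nmax => <-.
  by rewrite -(inj_eq val_inj) /=; have := ltn_ord i; lia.
by rewrite (sum_chain le_n chainD) -sum_fork; move: (\sum_(I | _ && (n1 \in _)) _)%N => s; lia.
Qed.

End TypeD.

Lemma type_D_rays (R : realType) r : (4 <= r)%N ->
  (extremal_rays (kostka_cone R (cartan_D r))
     #= `I_('C(r, 3) + 3 * 'C(r, 2) + 2 * 'C(r, 1) - 3))%card.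
Proof.
case: r => // n n3; apply: (kostka_rays_tree (tree_D n3)).
have := sum_D n3; rewrite !(binS n.+1) bin1.
by move: (\sum_(I | _) _)%N => s; lia.
Qed.

Local Open Scope classical_set_scope.
Local Open Scope card_scope.

Theorem proposition8p2 (R : realType) :
  (forall r : nat, (1 <= r)%N ->
     extremal_rays (kostka_cone R (cartan_A r))
       #= `I_('C(r.+1, 3) + 'C(r.+1, 2) + 'C(r.+1, 1) - 1)) /\
  (forall r : nat, (4 <= r)%N ->
     extremal_rays (kostka_cone R (cartan_D r))
       #= `I_('C(r, 3) + 3 * 'C(r, 2) + 2 * 'C(r, 1) - 3)) /\
  (forall r : nat, r \in [:: 6; 7; 8]%N ->
     extremal_rays (kostka_cone R (cartan_E r))
       #= `I_('C(r, 3) + 4 * 'C(r, 2) + 'C(r, 1) - 8)).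
Proof.
split; first exact: type_A_rays.
split; [exact: type_D_rays|exact: type_E_rays].
Qed.
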